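(* Suppose $X$ is sub-Gaussian with constant $C_1$ and let $\mu\in[\lambda_{d+1},\lambda_d]$. Put $C=8C_2+8C_3^2$. Then for all $r=0,\dots,d$ we have $$\mathbb E[\mathcal E^{PCA}_{\le d}(\mu)]\le C\sum_{j\le r}(\lambda_j-\mu)\frac{\lambda_j\operatorname{tr}(\Sigma)}{n(\lambda_j-\lambda_{d+1})^2}+\sum_{j=r+1}^{d\wedge(r+p-d)}(\lambda_j-\mu).$$ Moreover, if $d\le n/(16C_3^2)$, then for all $l=d+1,\dots,p+1$ we have $$\mathbb E[\mathcal E^{PCA}_{>d}(\mu)]\le C\sum_{k\ge l}(\mu-\lambda_k)\frac{\lambda_k\operatorname{tr}(\Sigma)}{n(\lambda_d-\lambda_k)^2}+\sum_{k=(d+1)\vee(l-d)}^{l-1}(\mu-\lambda_k)+R$$ with remainder term $R=(\mu-\lambda_p)e^{-n/(32C_3^2)}$. For $p=\infty$ one understands $\lambda_p=0$ and $l\in\{k\in\mathbb N: k\ge d+1\}\cup\{+\infty\}$, and for $l=p=\infty$ one understands $\sum_{k=(d+1)\vee(l-d)}^{l-1}(\mu-\lambda_k)=d\mu$.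
   Context: Let $(\mathcal H,\langle\cdot,\cdot\rangle)$ be a separable real Hilbert space of dimension $p\in\mathbb N\cup\{+\infty\}$ with norm $\|\cdot\|$, and let $X$ be a centered $\mathcal H$-valued random variable with $\mathbb E\|X\|^2<\infty$. Its covariance operator is $\Sigma=\mathbb E[X\otimes X]$, where $(u\otimes v)x=\langle v,x\rangle u$. Its eigenvalues (with multiplicity) are $\lambda_1\ge\lambda_2\ge\dots>0$, with corresponding eigenvectors $u_1,u_2,\dots$ which are assumed to form an orthonormal basis of $\mathcal H$ and are fixed; $P_j=u_j\otimes u_j$, $P_{\le d}=\sum_{j\le d}P_j$, $P_{>d}=I-P_{\le d}$. Let $X_1,\dots,X_n$ be $n\ge1$ independent copies of $X$, $\hat\Sigma=\frac1n\sum_{i=1}^nX_i\otimes X_i$, with eigenvalues $\hat\lambda_1\ge\hat\lambda_2\ge\dots\ge0$ and an orthonormal basis of eigenvectors $\hat u_1,\hat u_2,\dots$; $\hat P_j=\hat u_j\otimes\hat u_j$, $\hat P_{\le d}=\sum_{j\le d}\hat P_j$, $\hat P_{>d}=I-\hat P_{\le d}$. $\|\cdot\|_2$ is the Hilbert-Schmidt norm and $\|\cdot\|_\infty$ the operator norm. Here $d$ is an integer with $1\le d<p$. For $\mu\in\mathbb R$ put $$\mathcal E^{PCA}_{\le d}(\mu)=\sum_{j\le d}(\lambda_j-\mu)\|P_j\hat P_{>d}\|_2^2,\qquad \mathcal E^{PCA}_{>d}(\mu)=\sum_{k>d}(\mu-\lambda_k)\|P_k\hat P_{\le d}\|_2^2.$$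 $X$ is sub-Gaussian with constant $C_1$ if $\mathbb E\|X\|^2<\infty$ and $\sup_{k\ge1}k^{-1/2}\mathbb E[|\langle X,u\rangle|^k]^{1/k}\le C_1\mathbb E[\langle X,u\rangle^2]^{1/2}$ for all $u\in\mathcal H$. $C_2>0$ is the smallest constant such that $\mathbb E[\|P_j(\Sigma-\hat\Sigma)P_k\|_2^2]\le C_2\delta\lambda_j\lambda_k/n$ for all $j,k$, with $\delta=1$ if $j\ne k$ and $\delta=2$ if $j=k$. $C_3>1$ is a constant depending only on $C_1$ such that for every centered sub-Gaussian random variable with constant $C_1$ in a separable Hilbert space, with covariance $\Sigma$, largest eigenvalue $\lambda_1$ of $\Sigma$, and sample covariance $\hat\Sigma$ from $n$ independent copies, one has $\mathbb P(\|\Sigma-\hat\Sigma\|_\infty>C_3\lambda_1x)\le e^{-n(x\wedge x^2)}$ whenever $x>0$ and $\operatorname{tr}(\Sigma)\le n\lambda_1(x\wedge x^2)$ (the existence of such $C_3$ is a known theorem of Koltchinskii and Lounici). Convention: summands of the form $0/0$ (which occur when $\lambda_j=\mu=\lambda_{d+1}$, respectively $\lambda_k=\mu=\lambda_d$) are read as $0$. Here $a\wedge b=\min(a,b)$, $a\vee b=\max(a,b)$. *)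

(* Defs.v *)
From HB Require Import structures.
From mathcomp Require Export all_boot all_order all_algebra.
From mathcomp Require Export all_classical all_reals all_analysis.
Export Order.TTheory GRing.Theory Num.Theory.
Export numFieldNormedType.Exports.

Set Implicit Arguments.
Unset Strict Implicit.
Unset Printing Implicit Defensive.

Local Open Scope classical_set_scope.
Local Open Scope ring_scope.

HB.mixin Record CompleteNormedModule_isHilbert (R : realType) H
    of CompleteNormedModule R H := {
  inner : H -> H -> R ;
  innerC : forall x y : H, inner x y = inner y x ;
  innerDl : forall x y z : H, inner (x + y) z = inner x z + inner y z ;
  innerZl : forall (a : R) (x y : H), inner (a *: x) y = a * inner x y ;
  normr_inner : forall x : H, `|x| ^+ 2 = inner x x
}.

#[short(type="hilbertType")]
HB.structure Definition Hilbert (R : realType) :=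
  { H of CompleteNormedModule_isHilbert R H & CompleteNormedModule R H }.

(* Dimensions are elements of nat + {oo}, encoded as [option nat] with [None]
   for infinity.  Families indexed by 1, 2, ..., p are functions on nat whose
   values outside {1, ..., p} are irrelevant. *)
Definition in_dim (p : option nat) (j : nat) : bool :=
  (0 < j)%N && (if p is Some q then (j <= q)%N else true).

Section Operators.
Variables (R : realType) (H : hilbertType R).
Implicit Types (A B : H -> H) (e : nat -> H) (p : option nat).

(* The existence of such an [e] says that H is separable of dimension p. *)
Definition orthonormal_basis p e : Prop :=
  (forall j k, in_dim p j -> in_dim p k -> inner (e j) (e k) = (j == k)%:R) /\
  (forall x : H,
    (fun m : nat => \sum_(1 <= j < m.+1 | in_dim p j) inner x (e j) *: e j)
      @ \oo --> x).

Definition tensor (u v : H) : H -> H := fun x => inner v x *: u.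

Definition sub_op A B : H -> H := fun x => A x - B x.

Definition proj e (j : nat) : H -> H := tensor (e j) (e j).

Definition proj_le e (d : nat) : H -> H :=
  fun x => \sum_(1 <= j < d.+1) proj e j x.

Definition proj_gt e (d : nat) : H -> H := fun x => x - proj_le e d x.

Definition op_norm A : \bar R :=
  ereal_sup [set (`|A x|)%:E | x in [set x : H | `|x| <= 1]].

(* The squared Hilbert-Schmidt norm and the trace (of a positive operator),
   computed in an orthonormal basis [e]; their values do not depend on it. *)
Definition hs_norm_sq p e A : \bar R :=
  (\sum_(1 <= i <oo | in_dim p i) (`|A (e i)| ^+ 2)%:E)%E.

Definition trace p e A : \bar R :=
  (\sum_(1 <= i <oo | in_dim p i) (inner (A (e i)) (e i))%:E)%E.

Definition eigenpair A (a : R) (v : H) : Prop := v != 0 /\ A v = a *: v.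

Definition largest_eigenvalue A (a : R) : Prop :=
  (exists v, eigenpair A a v) /\ (forall b v, eigenpair A b v -> b <= a).

(* [e] is an orthonormal basis of eigenvectors, with the eigenvalues listed
   with multiplicity in nonincreasing order. *)
Definition spectral_decomposition p A (a : nat -> R) e : Prop :=
  [/\ orthonormal_basis p e,
      (forall j, in_dim p j -> A (e j) = a j *: e j) &
      (forall j k, in_dim p j -> in_dim p k -> (j <= k)%N -> a k <= a j)].

End Operators.

Section RandomVectors.
Variables (R : realType) (H : hilbertType R).
Variables (disp : measure_display) (T : measurableType disp)
  (P : probability T R).
Implicit Types (X Y : T -> H).

Definition borel_set (B : set H) : Prop := <<s @open H >> B.

Definition random_vector X : Prop :=
  forall B, borel_set B -> measurable (X @^-1` B).

(* The vector-valued expectation E Y = m, in the weak (Pettis) sense. *)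
Definition has_mean Y (m : H) : Prop :=
  forall v, ('E_P[fun w => inner (Y w) v] = (inner m v)%:E)%E.

Definition square_integrable X : Prop :=
  (\int[P]_w (`|X w| ^+ 2)%:E < +oo)%E.

Definition covariance_operator X (S : H -> H) : Prop :=
  forall x, has_mean (fun w => tensor (X w) (X w) x) (S x).

Definition sub_gaussian (C1 : R) X : Prop :=
  square_integrable X /\
  forall u : H,
    (ereal_sup [set ((Num.sqrt k%:R)^-1)%:E *
                    (\int[P]_w (`|inner (X w) u| ^+ k)%:E) `^ (k%:R^-1)
               | k in [set k : nat | (1 <= k)%N]]
     <= C1%:E * (\int[P]_w (inner (X w) u ^+ 2)%:E) `^ (2^-1))%E.

Definition independent_copies X (n : nat) (Xs : 'I_n -> T -> H) : Prop :=
  [/\ (forall i, random_vector (Xs i)),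
      (forall i B, borel_set B -> P (Xs i @^-1` B) = P (X @^-1` B)) &
      (forall B : 'I_n -> set H, (forall i, borel_set (B i)) ->
        P (\bigcap_(i in [set: 'I_n]) (Xs i @^-1` B i))
        = (\prod_(i < n) P (Xs i @^-1` B i))%E)].

Definition sample_covariance (n : nat) (Xs : 'I_n -> T -> H) (w : T) :
    H -> H :=
  fun x => n%:R^-1 *: \sum_(i < n) tensor (Xs i w) (Xs i w) x.

End RandomVectors.

(* The defining property of the constant C3 (Koltchinskii-Lounici). *)
Definition koltchinskii_lounici (R : realType) (C1 C3 : R) : Prop :=
  forall (H : hilbertType R) (p : option nat) (e : nat -> H)
    (disp : measure_display) (T : measurableType disp) (P : probability T R)
    (X : T -> H) (S : H -> H) (n : nat) (Xs : 'I_n -> T -> H) (l1 x : R),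
  orthonormal_basis p e ->
  random_vector X -> has_mean P X 0 -> sub_gaussian P C1 X ->
  covariance_operator P X S -> largest_eigenvalue S l1 ->
  (1 <= n)%N -> independent_copies P X Xs ->
  0 < x ->
  (trace p e S <= (n%:R * l1 * Num.min x (x ^+ 2))%:E)%E ->
  (P [set w | (C3 * l1 * x)%:E < op_norm (sub_op S (sample_covariance Xs w))]
   <= (expR (- (n%:R * Num.min x (x ^+ 2))))%:E)%E.

Section ReconstructionError.
Variables (R : realType) (H : hilbertType R) (p : option nat).
Variables (lam : nat -> R) (u : nat -> H).

Section FourthMoment.
Variables (disp : measure_display) (T : measurableType disp)
  (P : probability T R) (S : H -> H) (n : nat) (Xs : 'I_n -> T -> H).

Definition second_moment_bound (C : R) : Prop :=
  forall j k, in_dim p j -> in_dim p k ->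
  (\int[P]_w hs_norm_sq p u
     (proj u j \o sub_op S (sample_covariance Xs w) \o proj u k)
   <= (C * (if j == k then 2 else 1) * lam j * lam k / n%:R)%:E)%E.

(* The defining property of the constant C2. *)
Definition smallest_second_moment_constant (C2 : R) : Prop :=
  [/\ 0 < C2, second_moment_bound C2 &
      (forall C, 0 < C -> second_moment_bound C -> C2 <= C)].

End FourthMoment.

(* [v] stands for the empirical eigenvectors. *)
Definition excess_le (v : nat -> H) (d : nat) (mu : R) : \bar R :=
  (\sum_(1 <= j < d.+1)
     (lam j - mu)%:E * hs_norm_sq p u (proj u j \o proj_gt v d))%E.

Definition excess_gt (v : nat -> H) (d : nat) (mu : R) : \bar R :=
  (\sum_(d.+1 <= k <oo | in_dim p k)
     (mu - lam k)%:E * hs_norm_sq p u (proj u k \o proj_le v d))%E.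

Definition last_eigenvalue : R := if p is Some q then lam q else 0.

(* min(d, r + p - d) *)
Definition upper_index (d r : nat) : nat :=
  if p is Some q then minn d (r + q - d) else d.

(* l ranges over d+1, ..., p+1; [None] is the value l = oo, which is allowed
   (in addition to all finite l > d) exactly when p = oo. *)
Definition admissible_index (d : nat) (l : option nat) : Prop :=
  match p, l with
  | Some q, Some m => (d.+1 <= m <= q.+1)%N
  | Some _, None => False
  | None, Some m => (d.+1 <= m)%N
  | None, None => True
  end.

Definition sum_from (l : option nat) (f : nat -> \bar R) : \bar R :=
  if l is Some m then (\sum_(m <= k <oo | in_dim p k) f k)%E else 0%E.

Definition sum_below (d : nat) (l : option nat) (mu : R) : R :=
  if l is Some m then \sum_(maxn d.+1 (m - d) <= k < m) (mu - lam k)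
  else d%:R * mu.

End ReconstructionError.

(* Main.v *)
(* On the event that the empirical eigenvalue of index d+1 (resp. d) is within
   half a gap of its population counterpart, the identity
   <(Sigma - Sigma^) u_j, v_k> = (lam_j - hlam_k) <u_j, v_k>, squared and summed
   over k, bounds |P_j P^_{>d}|^2 (resp. |P_k P^_{<=d}|^2) by
   4 gap^-2 |(Sigma - Sigma^) u_j|^2, whose expectation is controlled by C2.
   On the complementary event the projection norm is at most 1, and by min-max
   that event forces a large operator norm: of the covariance error of P_{>d} X
   for the index d+1, and of the covariance error of the whitened vector
   sum_{j <= d} lam_j^{-1/2} P_j X for the index d; both are sub-Gaussian with
   constant C1, so the defining property of C3 applies.  The summands not
   treated this way form a knapsack problem: weights times numbers in [0, 1]
   whose sum is at most p - d (resp. d).  The remainder R collects the k with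
   lam_k <= lam_d / 2, for which a single bad event serves.
   The empirical eigenvectors need not be measurable in w, so the integrals are
   bounded through explicit measurable majorants. *)
Require Import Defs.
From mathcomp Require Import measurable_realfun ring lra zify.
Set Implicit Arguments.
Unset Strict Implicit.
Unset Printing Implicit Defensive.
Local Open Scope classical_set_scope.
Local Open Scope ring_scope.

(** * Real inner products: bilinearity, Cauchy-Schwarz, continuity *)

Section Inner.
Context {R : realType} {H : hilbertType R}.
Implicit Types (x y z : H) (a b : R).

Lemma innerDr x y z : inner x (y + z) = inner x y + inner x z.
Proof. by rewrite innerC innerDl !(innerC x). Qed.

Lemma innerZr a x y : inner x (a *: y) = a * inner x y.
Proof. by rewrite innerC innerZl innerC. Qed.

Lemma inner0l x : inner 0 x = 0.
Proof. by rewrite -(scale0r 0) innerZl mul0r. Qed.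

Lemma inner0r x : inner x 0 = 0.
Proof. by rewrite innerC inner0l. Qed.

Lemma innerNl x y : inner (- x) y = - inner x y.
Proof. by rewrite -scaleN1r innerZl mulN1r. Qed.

Lemma innerNr x y : inner x (- y) = - inner x y.
Proof. by rewrite innerC innerNl innerC. Qed.

Lemma innerBl x y z : inner (x - y) z = inner x z - inner y z.
Proof. by rewrite innerDl innerNl. Qed.

Lemma innerBr x y z : inner x (y - z) = inner x y - inner x z.
Proof. by rewrite innerDr innerNr. Qed.

Lemma inner_suml I (r : seq I) (Q : pred I) (F : I -> H) x :
  inner (\sum_(i <- r | Q i) F i) x = \sum_(i <- r | Q i) inner (F i) x.
Proof.
apply: (big_morph (fun y => inner y x)); first by move=> y z; rewrite innerDl.
exact: inner0l.
Qed.

Lemma inner_sumr I (r : seq I) (Q : pred I) (F : I -> H) x :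
  inner x (\sum_(i <- r | Q i) F i) = \sum_(i <- r | Q i) inner x (F i).
Proof. by rewrite innerC inner_suml; apply: eq_bigr => i _; rewrite innerC. Qed.

Lemma cauchy_schwarz x y : `|inner x y| <= `|x| * `|y|.
Proof.
have [->|y0] := eqVneq y 0; first by rewrite inner0r !normr0 mulr0.
have ny : 0 < `|y| ^+ 2 by rewrite exprn_gt0// normr_gt0.
rewrite -(@ler_pXn2r _ 2)// ?nnegrE ?mulr_ge0// exprMn.
(* The residual of [x] after projection onto the line of [y] has a nonnegative square; clearing the
   denominator gives the claim. *)
have := sqr_ge0 `|x - (inner x y / `|y| ^+ 2) *: y|.
rewrite normr_inner innerBl !innerBr !innerZl !innerZr -!normr_inner.
rewrite (innerC y x) real_normK ?num_real// -(@ler_pM2r _ (`|y| ^+ 2))// mul0r.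
suff -> : (`|x| ^+ 2 - inner x y / `|y| ^+ 2 * inner x y -
   (inner x y / `|y| ^+ 2 * inner x y -
    inner x y / `|y| ^+ 2 * (inner x y / `|y| ^+ 2 * `|y| ^+ 2))) * `|y| ^+ 2 =
   `|x| ^+ 2 * `|y| ^+ 2 - inner x y ^+ 2 by rewrite subr_ge0.
rewrite divfK ?gt_eqF//; field; by rewrite normr_eq0.
Qed.

Lemma inner_continuous x : continuous (fun y => inner y x).
Proof.
move=> y; apply/cvgrPdist_le => e e0.
near=> z; rewrite -innerBl (le_trans (cauchy_schwarz _ _))//.
have : `|y - z| <= e / (`|x| + 1).
  near: z; apply: cvgr_dist_le => //; first exact: divr_gt0.
move=> h; rewrite (le_trans (ler_wpM2r _ h))// -mulrA ler_piMr ?(ltW e0)//.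
by rewrite mulrC ler_pdivrMr// mul1r lerDl.
Unshelve. all: by end_near. Qed.

Lemma inner_self_continuous : continuous (fun x : H => `|x| ^+ 2 : R).
Proof.
move=> x; apply: (@cvg_comp _ _ _ (fun y : H => `|y|) (fun t : R => t ^+ 2)).
  exact: norm_continuous.
exact: exprn_continuous.
Qed.

Lemma sqnormZ a x : `|a *: x| ^+ 2 = a ^+ 2 * `|x| ^+ 2.
Proof. by rewrite normr_inner innerZl innerZr mulrA -normr_inner expr2. Qed.

End Inner.

Lemma in_dimW p j k : (0 < j <= k)%N -> in_dim p k -> in_dim p j.
Proof.
by case: p => [q|] /andP[j0 jk] /andP[k0 kp]; rewrite /in_dim j0//= (leq_trans jk).
Qed.

(** * Orthonormal bases: Parseval, projections, Hilbert-Schmidt norms *)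

Section Basis.
Context {R : realType} {H : hilbertType R} {p : option nat} {e : nat -> H}.
Hypothesis he : orthonormal_basis p e.
Implicit Types x y : H.

Lemma onb_norm j : in_dim p j -> `|e j| ^+ 2 = 1.
Proof. by case: he => o _ hj; rewrite normr_inner o// eqxx. Qed.

(** Pair the converging expansion of [x] with [y] and use continuity. The real-valued form is kept
    because the products have no fixed sign. *)
Lemma parseval_cvg x y :
  (fun m : nat => \sum_(1 <= j < m.+1 | in_dim p j) inner x (e j) * inner y (e j))
  @ \oo --> inner x y.
Proof.
case: he => _ hx.
have := cvg_comp _ _ (hx x) (@inner_continuous _ _ y x).
apply: cvg_trans; apply: near_eq_cvg; apply: nearW => m /=.
rewrite inner_suml; apply: eq_bigr => j _; by rewrite innerZl (innerC y).
Qed.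

Lemma parseval x :
  (\sum_(1 <= j <oo | in_dim p j) (inner x (e j) ^+ 2)%:E = (`|x| ^+ 2)%:E)%E.
Proof.
apply/cvg_lim => //.
rewrite -cvg_shiftS; under eq_fun do rewrite sumEFin.
apply: (@cvg_comp _ _ _ _ EFin _ (nbhs (`|x| ^+ 2))); last by [].
rewrite normr_inner; have := @parseval_cvg x x.
apply: cvg_trans; apply: near_eq_cvg; apply: nearW => m /=.
by [].
Qed.

Lemma bessel x m : \sum_(1 <= j < m | in_dim p j) inner x (e j) ^+ 2 <= `|x| ^+ 2.
Proof.
rewrite -lee_fin -parseval -sumEFin.
by apply: nneseries_lim_ge => j _ _; rewrite lee_fin sqr_ge0.
Qed.

Lemma basis_ext x y :
  (forall j, in_dim p j -> inner x (e j) = inner y (e j)) -> x = y.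
Proof.
move=> h; apply/eqP; rewrite -subr_eq0 -normr_eq0 -sqrf_eq0.
rewrite -(inj_eq (@EFin_inj R)) -parseval eseries0// => j _ hj.
by rewrite innerBl h// subrr expr0n.
Qed.

Lemma inner_onb_sum m (a : nat -> R) k : in_dim p k ->
  inner (\sum_(1 <= j < m | in_dim p j) a j *: e j) (e k) =
  if (k < m)%N then a k else 0.
Proof.
case: he => o _ hk; rewrite inner_suml big_mkcond/=.
case: ifPn => km.
  rewrite (bigD1_seq k) ?iota_uniq//=; last first.
    by rewrite mem_index_iota km andbT; case/andP: hk.
  rewrite hk innerZl o// eqxx mulr1 big1 ?addr0// => j /negbTE jk.
  by case: ifP => // hj; rewrite innerZl o// jk mulr0.
rewrite big_nat_cond big1// => j /andP[/andP[_ jm] _].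
case: ifP => // hj; rewrite innerZl o//.
by case: eqP => [jk|_]; [rewrite jk (negbTE km) in jm | rewrite mulr0].
Qed.

Lemma sqnorm_onb_sum m (a : nat -> R) :
  `|\sum_(1 <= j < m | in_dim p j) a j *: e j| ^+ 2 =
  \sum_(1 <= j < m | in_dim p j) a j ^+ 2.
Proof.
rewrite normr_inner inner_sumr big_nat_cond [RHS]big_nat_cond.
apply: eq_bigr => k /andP[/andP[_ km] hk].
by rewrite innerZr inner_onb_sum// km expr2.
Qed.

Lemma big_in_dim {T : Type} {idx : T} {op : T -> T -> T} d (F : nat -> T) : in_dim p d ->
  \big[op/idx]_(1 <= j < d.+1) F j = \big[op/idx]_(1 <= j < d.+1 | in_dim p j) F j.
Proof.
move=> hd; rewrite big_nat_cond [RHS]big_nat_cond; apply: eq_bigl => j.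
case: (boolP (0 < j < d.+1)%N) => //= /andP[j0 jd]; symmetry.
by apply: (in_dimW _ hd); rewrite j0.
Qed.

Lemma inner_proj_le d x k : in_dim p d -> in_dim p k ->
  inner (proj_le e d x) (e k) = if (k <= d)%N then inner x (e k) else 0.
Proof.
move=> hd hk; rewrite /proj_le big_in_dim// /proj /tensor.
rewrite (eq_bigr (fun j => inner x (e j) *: e j)) => [|j _]; last by rewrite innerC.
by rewrite inner_onb_sum// ltnS.
Qed.

Lemma inner_proj_gt d x k : in_dim p d -> in_dim p k ->
  inner (proj_gt e d x) (e k) = if (k <= d)%N then 0 else inner x (e k).
Proof.
move=> hd hk; rewrite innerBl inner_proj_le//.
by case: ifP; rewrite ?subrr ?subr0.
Qed.

Lemma proj_le_sym d x y : inner (proj_le e d x) y = inner x (proj_le e d y).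
Proof.
rewrite /proj_le inner_suml inner_sumr; apply: eq_bigr => j _.
by rewrite /proj /tensor innerZl innerZr mulrC (innerC x).
Qed.

Lemma proj_gt_sym d x y : inner (proj_gt e d x) y = inner x (proj_gt e d y).
Proof. by rewrite innerBl innerBr proj_le_sym. Qed.

Lemma sqnorm_proj_le d x : in_dim p d ->
  `|proj_le e d x| ^+ 2 = \sum_(1 <= j < d.+1) inner x (e j) ^+ 2.
Proof.
move=> hd; rewrite [RHS]big_in_dim// /proj_le big_in_dim// sqnorm_onb_sum.
by apply: eq_bigr => j _; rewrite innerC.
Qed.

Lemma proj_le_idem d x : in_dim p d -> proj_le e d (proj_le e d x) = proj_le e d x.
Proof.
by move=> hd; apply: basis_ext => k hk; rewrite !inner_proj_le//; case: leqP.
Qed.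

Lemma inner_proj_le_self d x : in_dim p d ->
  inner (proj_le e d x) x = `|proj_le e d x| ^+ 2.
Proof. by move=> hd; rewrite normr_inner [RHS]proj_le_sym proj_le_idem// innerC. Qed.

Lemma sqnorm_proj_gt d x : in_dim p d ->
  `|proj_gt e d x| ^+ 2 = `|x| ^+ 2 - `|proj_le e d x| ^+ 2.
Proof.
move=> hd; rewrite /proj_gt [LHS]normr_inner innerBl !innerBr -!normr_inner.
by rewrite (innerC x) inner_proj_le_self// subrr subr0.
Qed.

(** For symmetric [B], P_j B maps e_i to <B e_j, e_i> e_j, so the sum over i is the Parseval series
    of [B (e j)]. Both excess risks thus become weighted sums of squared norms. *)
Lemma hs_norm_sq_proj (B : H -> H) j : in_dim p j ->
  (forall x y, inner (B x) y = inner x (B y)) ->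
  hs_norm_sq p e (proj e j \o B) = (`|B (e j)| ^+ 2)%:E.
Proof.
move=> hj symB; rewrite -parseval; apply: eq_eseriesr => i hi.
rewrite /proj /tensor /= sqnormZ onb_norm// mulr1; congr (_ ^+ 2)%:E.
by rewrite symB.
Qed.

(** Only e_k survives the right projection, which leaves one squared matrix entry; the bound
    defining [C2] is used in this form. *)
Lemma hs_norm_sq_proj2 (A : H -> H) j k : in_dim p j -> in_dim p k ->
  (forall a x, A (a *: x) = a *: A x) ->
  hs_norm_sq p e (proj e j \o A \o proj e k) = (inner (A (e k)) (e j) ^+ 2)%:E.
Proof.
move=> hj hk AZ; rewrite /hs_norm_sq.
have h1 : (1 <= k)%N by case/andP: hk.
rewrite ereal_series_cond (@nneseriesD1 _ _ k) ?hk ?h1//.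
rewrite eseries0 ?adde0 => [|i _ /andP[/andP[_ hi] ik]].
  rewrite /proj /tensor /= AZ innerZr sqnormZ onb_norm// mulr1 exprMn.
  by rewrite -normr_inner onb_norm// expr1n mul1r innerC.
case: (he) => o _.
rewrite /proj /tensor /= AZ innerZr sqnormZ o//.
by rewrite eq_sym (negbTE ik) mul0r expr0n mul0r.
Qed.

End Basis.
Arguments parseval_cvg {R H p e} he x y.

(** * Symmetric operators and the operator norm *)

Section SymmetricOperators.
Context {R : realType} {H : hilbertType R}.
Implicit Types (x y z : H) (A : H -> H).

Lemma inner_ext x y : (forall z, inner x z = inner y z) -> x = y.
Proof.
move=> h; apply/eqP; rewrite -subr_eq0 -normr_eq0 -sqrf_eq0 normr_inner.
by rewrite innerBl h subrr.
Qed.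

Definition sym_op A := forall x y, inner (A x) y = inner x (A y).

(** Operators are bare functions; symmetry, tested against every vector, forces linearity. *)
Lemma sym_opZ A : sym_op A -> forall a x, A (a *: x) = a *: A x.
Proof. by move=> sA a x; apply: inner_ext => z; rewrite sA !innerZl sA. Qed.

Lemma sym_opB A : sym_op A -> {morph A : x y / x - y}.
Proof. by move=> sA x y; apply: inner_ext => z; rewrite sA !innerBl !sA. Qed.

Lemma sym_op0 A : sym_op A -> A 0 = 0.
Proof. by move=> sA; rewrite -(scale0r 0) sym_opZ// !scale0r. Qed.

Lemma sym_sub_op A B : sym_op A -> sym_op B -> sym_op (sub_op A B).
Proof. by move=> sA sB x y; rewrite /sub_op innerBl innerBr sA sB. Qed.

Lemma sym_conj A B : sym_op A -> sym_op B -> sym_op (A \o B \o A).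
Proof. by move=> sA sB x y; rewrite /= sA sB sA. Qed.

Lemma sym_bounded_continuous A (c : R) : sym_op A ->
  (forall x, `|A x| <= c * `|x|) -> continuous A.
Proof.
move=> sA Ac x; apply/cvgrPdist_le => eps e0.
have c0 : 0 < `|c| + 1 by rewrite ltr_pwDr.
near=> z; rewrite -sym_opB// (le_trans (Ac _))//.
have h : `|x - z| <= eps / (`|c| + 1).
  near: z; apply: cvgr_dist_le => //; first exact: divr_gt0.
apply: (@le_trans _ _ ((`|c| + 1) * `|x - z|)).
  by rewrite ler_wpM2r// (le_trans (ler_norm c))// lerDl.
by rewrite mulrC -ler_pdivlMr.
Unshelve. all: by end_near. Qed.

Lemma op_norm_gtP A (c : R) : sym_op A -> 0 <= c ->
  (c%:E < op_norm A)%E <-> exists y, c * `|y| < `|A y|.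
Proof.
move=> sA c0; split=> [|[y hy]].
  move/ereal_sup_gt => [_ [x /= x1 <-]]; rewrite lte_fin => h.
  by exists x; rewrite (le_lt_trans _ h)// ler_piMr.
have y0 : 0 < `|y|.
  rewrite normr_gt0; apply: contraTneq hy => ->.
  by rewrite sym_op0// !normr0 mulr0 ltxx.
apply: (@lt_le_trans _ _ (`|A (`|y|^-1 *: y)|)%:E).
  by rewrite lte_fin sym_opZ// normrZ normfV normr_id mulrC ltr_pdivlMr.
apply: ereal_sup_ubound => /=; exists (`|y|^-1 *: y) => //=.
by rewrite normrZ normfV normr_id mulVf ?gt_eqF.
Qed.

(** Cauchy-Schwarz. The hypothesis is a negation because it is applied off an event of the form
    [c%:E < op_norm A]. *)
Lemma op_norm_le_quad A (c : R) x : sym_op A -> 0 <= c ->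
  ~ (c%:E < op_norm A)%E -> `|inner (A x) x| <= c * `|x| ^+ 2.
Proof.
move=> sA c0 h; rewrite (le_trans (cauchy_schwarz _ _))// expr2 mulrA.
rewrite ler_wpM2r// leNgt; apply/negP => hx; apply: h.
by apply/op_norm_gtP => //; exists x.
Qed.

End SymmetricOperators.

(** * A countable dense set of test vectors *)

Section RationalCombinations.
Context {R : realType} {H : hilbertType R} {p : option nat} {e : nat -> H}.

(** Finite sequences of rationals form a countable type; the shift to [i.+1] matches bases indexed
    from 1. *)
Definition rat_comb (s : seq rat) : H :=
  \sum_(i < size s) ratr (nth 0 s i) *: e i.+1.

Lemma rat_comb_rcons s q :
  rat_comb (rcons s q) = rat_comb s + ratr q *: e (size s).+1.
Proof.
rewrite /rat_comb size_rcons big_ord_recr/= nth_rcons ltnn eqxx; congr (_ + _).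
by apply: eq_bigr => i _; rewrite nth_rcons ltn_ord.
Qed.

Lemma rat_comb_near_sum (a : nat -> R) m (eps : R) : 0 < eps ->
  exists2 s, size s = m & `|\sum_(1 <= j < m.+1) a j *: e j - rat_comb s| < eps.
Proof.
elim: m eps => [|m IHm] eps e0.
  by exists [::] => //; rewrite /rat_comb big_geq// big_ord0 subrr normr0.
have [s hs1 hs2] := IHm (eps / 2) (divr_gt0 e0 (ltr0Sn _ _)).
(* Here [e] is an arbitrary family; the [+ 1] keeps the denominator positive even for a zero
   vector. *)
have c0 : 0 < `|e m.+1| + 1 by rewrite ltr_pwDr.
have d0 : 0 < eps / 2 / (`|e m.+1| + 1) by rewrite !divr_gt0.
have [q] := @rat_in_itvoo R (a m.+1 - eps / 2 / (`|e m.+1| + 1))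
  (a m.+1 + eps / 2 / (`|e m.+1| + 1)) ltac:(lra).
rewrite in_itv/= => /andP[q1 q2]; exists (rcons s q); first by rewrite size_rcons hs1.
rewrite big_nat_recr//= rat_comb_rcons hs1 opprD addrACA -scalerBl.
rewrite (le_lt_trans (ler_normD _ _))// [ltRHS]splitr ltr_leD// normrZ.
have h : `|a m.+1 - ratr q| <= eps / 2 / (`|e m.+1| + 1).
  by rewrite ler_norml; apply/andP; split; lra.
rewrite (le_trans (ler_wpM2r _ h))// mulrAC ler_pdivrMr// ler_pM2l ?lerDl//; exact: divr_gt0.
Qed.

Lemma rat_comb_dense x (eps : R) : orthonormal_basis p e -> 0 < eps ->
  exists s, `|x - rat_comb s| < eps.
Proof.
move=> [_ hx] e0; have e2 : 0 < eps / 2 by rewrite divr_gt0.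
have /cvgrPdist_lt/(_ _ e2)[m _ /(_ m (leqnn m))] := hx x => hm.
(* The approximated sum runs over all indices up to [m], so those outside the dimension get
   coefficient 0. *)
have [s _ hs] := rat_comb_near_sum
  (fun j => if in_dim p j then inner x (e j) else 0) m e2.
exists s; rewrite -[x in x - _](subrK
  (\sum_(1 <= j < m.+1 | in_dim p j) inner x (e j) *: e j)) -addrA.
rewrite (le_lt_trans (ler_normD _ _))// [ltRHS]splitr ltrD//.
rewrite big_mkcond/=; congr (`| _ - _ | < _): hs.
by apply: eq_bigr => j _; case: ifP => //; rewrite scale0r.
Qed.

End RationalCombinations.
Arguments rat_comb {R H} e s.

(** * Random vectors: measurability and covariance operators *)

Section RandomVectorTheory.
Context {R : realType} {H : hilbertType R} {disp : measure_display}
  {T : measurableType disp} {P : probability T R}.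
Implicit Types (X Y : T -> H) (L S : H -> H).

(** The sets whose preimage is Borel form a sigma-algebra containing the open sets. *)
Lemma borel_preimage L (B : set H) : continuous L ->
  borel_set B -> borel_set (L @^-1` B).
Proof.
move=> /continuousP cL.
have [s0 sD sU] := smallest_sigma_algebra setT (@open H).
move: B; apply: smallest_sub => [|B oB]; last exact: sub_sigma_algebra (cL _ oB).
split => [|A|F] /=; first by rewrite preimage_set0.
  exact: sD.
by rewrite preimage_bigcup; exact: sU.
Qed.

Lemma random_vector_comp L X : continuous L -> random_vector X -> random_vector (L \o X).
Proof. by move=> cL hX B /(borel_preimage cL); exact: hX. Qed.

Lemma measurable_continuous_random_vector (f : H -> R) X : continuous f ->
  random_vector X -> measurable_fun setT (f \o X).
Proof.
move=> /continuousP cf hX; apply: (measurability _ (RGenOpens.measurableE R)).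
move=> _ [_ [a [b ->] <-]]; rewrite setTI comp_preimage; apply: hX.
by apply: sub_sigma_algebra; apply/cf/interval_open.
Qed.

Lemma measurable_inner X y : random_vector X ->
  measurable_fun setT (fun w => inner (X w) y).
Proof. exact: measurable_continuous_random_vector (@inner_continuous R H y). Qed.

Lemma measurable_sqnorm X : random_vector X ->
  measurable_fun setT (fun w => `|X w| ^+ 2).
Proof. exact: measurable_continuous_random_vector (@inner_self_continuous R H). Qed.

Lemma covariance_operatorE X S x y : covariance_operator P X S ->
  (\int[P]_w (inner (X w) x * inner (X w) y)%:E = (inner (S x) y)%:E)%E.
Proof.
move=> /(_ x y) <-; rewrite unlock; apply: eq_integral => w _.
by rewrite /tensor innerZl.
Qed.

Lemma covariance_operator_sym X S : covariance_operator P X S -> sym_op S.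
Proof.
move=> cS x y; suff [->] : (inner (S x) y)%:E = (inner (S y) x)%:E by rewrite innerC.
rewrite -!(covariance_operatorE _ _ cS).
by apply: eq_integral => w _; rewrite mulrC.
Qed.

Lemma inner_sample_covariance n (Xs : 'I_n -> T -> H) w x y :
  inner (sample_covariance Xs w x) y =
  n%:R^-1 * \sum_(i < n) inner (Xs i w) x * inner (Xs i w) y.
Proof.
rewrite /sample_covariance innerZl inner_suml; congr (_ * _).
by apply: eq_bigr => i _; rewrite /tensor innerZl.
Qed.

Lemma sample_covariance_sym n (Xs : 'I_n -> T -> H) w :
  sym_op (sample_covariance Xs w).
Proof.
move=> x y; rewrite [RHS]innerC !inner_sample_covariance; congr (_ * _).
by apply: eq_bigr => i _; rewrite mulrC.
Qed.

Lemma measurable_inner_sample_covariance n (Xs : 'I_n -> T -> H) x y :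
  (forall i, random_vector (Xs i)) ->
  measurable_fun setT (fun w => inner (sample_covariance Xs w x) y).
Proof.
move=> hX; under eq_fun do rewrite inner_sample_covariance.
apply: measurable_funM => //; apply: measurable_sum => i.
by apply: measurable_funM; exact: measurable_inner.
Qed.

(* Only countably many test vectors are needed: the condition
   [c^2 |y|^2 < sum_(k <= m) <A y, e_k>^2] is open in [y]. *)
Lemma measurable_op_norm_gt (p : option nat) (e : nat -> H) (A : T -> H -> H) (c : R) :
  orthonormal_basis p e -> 0 <= c -> (forall w, sym_op (A w)) ->
  (forall x y, measurable_fun setT (fun w => inner (A w x) y)) ->
  measurable [set w | (c%:E < op_norm (A w))%E].
Proof.
move=> he c0 sA mA.
pose F m w y := \sum_(1 <= j < m.+1 | in_dim p j) inner (A w y) (e j) ^+ 2.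
have -> : [set w | (c%:E < op_norm (A w))%E] =
    \bigcup_(ms : nat * seq rat)
       [set w | c ^+ 2 * `|rat_comb e ms.2| ^+ 2 < F ms.1 w (rat_comb e ms.2)].
  apply/seteqP; split => w /=.
    move/op_norm_gtP => /(_ (sA w) c0)[y cy].
    have {}cy : c ^+ 2 * `|y| ^+ 2 < `|A w y| ^+ 2.
      by rewrite -exprMn ltr_pXn2r// ?nnegrE ?mulr_ge0.
    have [m hm] : exists m, c ^+ 2 * `|y| ^+ 2 < F m w y.
      have := parseval_cvg he (A w y) (A w y); rewrite -normr_inner.
      have cy0 : 0 < `|A w y| ^+ 2 - c ^+ 2 * `|y| ^+ 2 by rewrite subr_gt0.
      move=> /cvgrPdist_lt/(_ _ cy0)[m _].
      move=> /(_ m (leqnn m)) /=; rewrite ltr_norml => /andP[_ h].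
      exists m; rewrite /F; under eq_bigr do rewrite expr2.
      by move: h; lra.
    have cF : continuous (fun z => F m w z - c ^+ 2 * `|z| ^+ 2).
      move=> z; apply: cvgB.
        apply: (cvg_big (op := +%R)) => [|j _]; first exact: add_continuous.
        (* Moving [A w] onto the fixed vector e_j makes each coordinate continuous in [z] without a
           bound on [A w]. *)
        rewrite sA; under eq_fun do rewrite sA.
        exact: (@cvg_comp _ _ _ (fun z => inner z (A w (e j))) (fun t : R => t ^+ 2) _ _ _
          (@inner_continuous _ _ _ z) (@exprn_continuous R 2 _)).
      by apply: cvgM; [exact: cvg_cst | exact: inner_self_continuous].
    have : nbhs y [set z | 0 < F m w z - c ^+ 2 * `|z| ^+ 2].
      by apply: (cvgr_gt _ (cF y)); rewrite subr_gt0.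
    rewrite -nbhs_ballE => -[eps /= eps0 hb].
    have [s hs] := rat_comb_dense y he eps0.
    exists (m, s) => //=; rewrite -subr_gt0; apply: hb.
    by rewrite -ball_normE.
  move=> [[m s] _ /= h]; apply/op_norm_gtP => //.
  exists (rat_comb e s); rewrite -(@ltr_pXn2r _ 2)// ?nnegrE ?mulr_ge0// exprMn.
  exact: lt_le_trans h (bessel he _ _).
apply: countable_bigcupT_measurable => [|[m s]/=].
  exact: countableP.
rewrite -[X in measurable X]setTI.
apply: (@measurable_fun_ltr _ _ _ setT
  (fun=> c ^+ 2 * `|rat_comb e s| ^+ 2) (fun w => F m w (rat_comb e s))) => //.
have -> : F m ^~ (rat_comb e s) = fun w => \sum_(1 <= j < m.+1)
    if in_dim p j then inner (A w (rat_comb e s)) (e j) ^+ 2 else 0.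
  by apply/funext => w; rewrite /F big_mkcond.
apply: measurable_sum => j; case: (in_dim p j) => //.
by apply: measurable_funX; exact: mA.
Qed.

End RandomVectorTheory.

(* The integral of a nonnegative function is a supremum over the simple
   functions below it, so that monotonicity needs no measurability. *)
Lemma le_integral_ge0 d (T : measurableType d) (R : realType)
    (mu : {measure set T -> \bar R}) (f g : T -> \bar R) :
  (forall w, 0 <= f w)%E -> (forall w, f w <= g w)%E ->
  (\int[mu]_w f w <= \int[mu]_w g w)%E.
Proof.
move=> f0 fg; rewrite !ge0_integralTE// => [|w]; last exact: le_trans (f0 w) _.
apply: le_ereal_sup => _ [h /= hf <-]; exists h => // w.
exact: le_trans (hf w) (fg w).
Qed.

(** * Concentration for the transformed vector [L \o X] *)

Section Conjugation.
Context {R : realType} {H : hilbertType R} {disp : measure_display}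
  {T : measurableType disp} {P : probability T R}.
Context {p : option nat} {e : nat -> H} {X : T -> H} {S : H -> H} {n : nat}
  {Xs : 'I_n -> T -> H} {C1 C3 : R}.
Hypotheses (he : orthonormal_basis p e) (hX : random_vector X)
  (X0 : has_mean P X 0) (hsub : sub_gaussian P C1 X)
  (hS : covariance_operator P X S) (n1 : (1 <= n)%N)
  (hXs : independent_copies P X Xs) (hC3 : koltchinskii_lounici C1 C3).
Variables (L : H -> H) (c : R).
Hypotheses (symL : sym_op L) (Lc : forall x, `|L x| <= c * `|x|).

Lemma has_mean_conj : has_mean P (L \o X) 0.
Proof.
move=> v; rewrite inner0l; have := X0 (L v); rewrite inner0l => <-.
by congr expectation; apply/funext => w /=; rewrite symL.
Qed.

Lemma square_integrable_conj : square_integrable P (L \o X).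
Proof.
have [hX2 _] := hsub.
apply: (@le_lt_trans _ _ (\int[P]_w ((c ^+ 2)%:E * (`|X w| ^+ 2)%:E))%E).
  apply: le_integral_ge0 => w; first by rewrite lee_fin sqr_ge0.
  rewrite -EFinM lee_fin -exprMn lerXn2r// ?nnegrE//.
  by rewrite (le_trans (normr_ge0 _) (Lc _)).
  exact: Lc.
rewrite ge0_integralZl//; last 2 first.
- by apply/measurable_EFinP; exact: measurable_sqnorm.
- by rewrite lee_fin sqr_ge0.
by apply: lte_mul_pinfty => //; rewrite lee_fin sqr_ge0.
Qed.

(** Since <L X, v> = <X, L v>, the moment bound in direction [v] is that of [X] in direction [L v],
    with the same constant. *)
Lemma sub_gaussian_conj : sub_gaussian P C1 (L \o X).
Proof.
split; first exact: square_integrable_conj.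
move=> v; have [_ /(_ (L v))] := hsub.
(* Abstracting the two integrands replaces rewriting under several integrals by one equality of
   functions. *)
suff E (Y Y' : T -> R) : Y =1 Y' ->
    (ereal_sup [set ((Num.sqrt k%:R)^-1)%:E *
       (\int[P]_w (`|Y w| ^+ k)%:E) `^ (k%:R^-1) | k in [set k : nat | (1 <= k)%N]]
     <= C1%:E * (\int[P]_w (Y w ^+ 2)%:E) `^ (2^-1))%E ->
    (ereal_sup [set ((Num.sqrt k%:R)^-1)%:E *
       (\int[P]_w (`|Y' w| ^+ k)%:E) `^ (k%:R^-1) | k in [set k : nat | (1 <= k)%N]]
     <= C1%:E * (\int[P]_w (Y' w ^+ 2)%:E) `^ (2^-1))%E.
  by apply: E => w /=; rewrite symL.
by move=> /funext ->.
Qed.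

Lemma covariance_operator_conj : covariance_operator P (L \o X) (L \o S \o L).
Proof.
move=> x v; rewrite /= symL -(hS (L x) (L v)).
congr expectation; apply/funext => w; rewrite /tensor /= !innerZl.
by rewrite !symL.
Qed.

Lemma independent_copies_conj :
  independent_copies P (L \o X) (fun i => L \o Xs i).
Proof.
have cL := sym_bounded_continuous symL Lc; case: hXs => h1 h2 h3; split.
- by move=> i; exact: random_vector_comp.
- by move=> i B hB; exact: (h2 i _ (borel_preimage cL hB)).
- by move=> B hB; exact: (h3 (fun i => L @^-1` B i) (fun i => borel_preimage cL (hB i))).
Qed.

Lemma sample_covariance_conj w :
  sample_covariance (fun i => L \o Xs i) w = L \o sample_covariance Xs w \o L.
Proof.
apply/funext => x; apply: inner_ext => y /=.
rewrite symL !inner_sample_covariance; congr (_ * _); apply: eq_bigr => i _ /=.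
by rewrite !symL.
Qed.

(** The covariances of the transformed vector are written as conjugates of those of [X], so that
    eigenvalue comparisons act on the operators of [X] directly. *)
Definition conj_deviation (t : R) : set T :=
  [set w | (t%:E < op_norm
     (sub_op (L \o S \o L) (L \o sample_covariance Xs w \o L)))%E].

Lemma measurable_conj_deviation t : 0 <= t -> measurable (conj_deviation t).
Proof.
move=> t0; have sS := covariance_operator_sym hS.
apply: (measurable_op_norm_gt he t0) => [w|x y].
  by apply: sym_sub_op; apply: sym_conj => //; exact: sample_covariance_sym.
rewrite /sub_op; under eq_fun do rewrite innerBl /= 2!symL.
apply: measurable_funB => //.
by case: hXs => hrv _ _; exact: measurable_inner_sample_covariance.
Qed.

Lemma conj_deviation_bound (l1 x : R) :
  largest_eigenvalue (L \o S \o L) l1 -> 0 < x ->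
  (trace p e (L \o S \o L) <= (n%:R * l1 * Num.min x (x ^+ 2))%:E)%E ->
  (P (conj_deviation (C3 * l1 * x)) <= (expR (- (n%:R * Num.min x (x ^+ 2))))%:E)%E.
Proof.
move=> hl x0 htr.
have cL := sym_bounded_continuous symL Lc.
have := hC3 he (random_vector_comp cL hX) has_mean_conj sub_gaussian_conj
  covariance_operator_conj hl n1 independent_copies_conj x0 htr.
by under eq_set do rewrite sample_covariance_conj.
Qed.

(** Trades the exponential for a rational bound of the same shape as the second-moment term. If the
    trace condition holds, exp(-z) <= 1/z with z = n min(x, x^2); if it fails, the right side is at
    least 1. The lower bound on [K] closes both cases. *)
Lemma conj_deviation_tail (l1 x tr K : R) : 0 <= C3 ->
  largest_eigenvalue (L \o S \o L) l1 -> 0 < l1 <= tr ->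
  (trace p e (L \o S \o L) <= tr%:E)%E -> 0 < x -> 0 <= K ->
  1 <= K * Num.min x (x ^+ 2) ->
  (P (conj_deviation (C3 * l1 * x)) <= (K * tr / (n%:R * l1))%:E)%E.
Proof.
move=> C30 hl /andP[l0 ltr] htr x0 K0; set m := Num.min _ _ => Km.
have m0 : 0 < m by rewrite lt_min x0 exprn_gt0.
have n0 : 0 < n%:R :> R by rewrite ltr0n.
have [h|h] := leP tr (n%:R * l1 * m).
  apply: le_trans (conj_deviation_bound hl x0 _) _; first by rewrite (le_trans htr).
  rewrite -/m lee_fin expRN.
  apply: (@le_trans _ _ (n%:R * m)^-1).
    rewrite lef_pV2 ?posrE ?expR_gt0 ?mulr_gt0//.
    by rewrite (le_trans _ (expR_ge1Dx _))// lerDr.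
  rewrite -[leLHS]div1r ler_pdivrMr ?mulr_gt0//.
  have -> : K * tr / (n%:R * l1) * (n%:R * m) = (K * m) * (tr / l1).
    by field; rewrite !gt_eqF.
  by rewrite mulr_ege1// ler_pdivlMr ?mul1r.
apply: (@le_trans _ _ 1%E).
  by apply: probability_le1; apply: measurable_conj_deviation; rewrite !mulr_ge0// ltW.
rewrite lee_fin ler_pdivlMr ?mulr_gt0// mul1r.
apply: (@le_trans _ _ (n%:R * l1 * (K * m))).
  by rewrite ler_peMr// mulr_ge0// ltW.
by rewrite mulrCA ler_wpM2l// ltW.
Qed.

End Conjugation.
Arguments conj_deviation {R H disp T} S {n} Xs L t.

(** * Quadratic forms, min-max vectors and truncated diagonal operators *)

Section Spectral.
Context {R : realType} {H : hilbertType R} {p : option nat}.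
Implicit Types (x y : H) (e f u v : nat -> H) (A B S : H -> H) (a lam h : nat -> R).

Lemma sqnorm_le_basis e x y : orthonormal_basis p e ->
  (forall k, in_dim p k -> inner x (e k) ^+ 2 <= inner y (e k) ^+ 2) ->
  `|x| ^+ 2 <= `|y| ^+ 2.
Proof.
move=> he hxy; rewrite -lee_fin -!(parseval he); apply: lee_nneseries => k.
  by rewrite lee_fin sqr_ge0.
by rewrite lee_fin; exact: hxy.
Qed.

(** By Parseval the form is a limit of weighted sums of squared coordinates, so [c] must dominate
    [a j] only where [x] has a nonzero coordinate. *)
Lemma quad_le e A a x (c : R) : orthonormal_basis p e -> sym_op A ->
  (forall j, in_dim p j -> A (e j) = a j *: e j) ->
  (forall j, in_dim p j -> inner x (e j) != 0 -> a j <= c) ->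
  inner (A x) x <= c * `|x| ^+ 2.
Proof.
move=> he sA hA hc; rewrite normr_inner.
apply: (ler_cvg_to (parseval_cvg he (A x) x) (cvgM (cvg_cst c) (parseval_cvg he x x))).
apply: nearW => m /=; rewrite mulr_sumr; apply: ler_sum => j hj.
rewrite sA hA// innerZr; have [->|h0] := eqVneq (inner x (e j)) 0.
  by rewrite !mulr0.
by rewrite -mulrA ler_wpM2r ?hc// -expr2 sqr_ge0.
Qed.

Lemma quad_ge e A a x (c : R) : orthonormal_basis p e -> sym_op A ->
  (forall j, in_dim p j -> A (e j) = a j *: e j) ->
  (forall j, in_dim p j -> inner x (e j) != 0 -> c <= a j) ->
  c * `|x| ^+ 2 <= inner (A x) x.
Proof.
move=> he sA hA hc; rewrite -[leRHS]opprK -innerNl lerNr -mulNr.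
apply: (@quad_le e (fun x => - A x) (fun j => - a j)) => //.
- by move=> y z; rewrite innerNl innerNr sA.
- by move=> j hj; rewrite hA// scaleNr.
- by move=> j hj h0; rewrite lerN2 hc.
Qed.

(** Pairing an eigenvalue equation with a basis vector not orthogonal to the eigenvector shows that
    every eigenvalue is some [a j]. *)
Lemma largest_eigenvalueP e A a k : orthonormal_basis p e -> sym_op A ->
  (forall j, in_dim p j -> A (e j) = a j *: e j) -> in_dim p k ->
  (forall j, in_dim p j -> a j <= a k) -> largest_eigenvalue A (a k).
Proof.
move=> he sA hA hk ha; split=> [|b v [v0 hv]].
  exists (e k); split; last exact: hA.
  by rewrite -normr_eq0 -sqrf_eq0 (onb_norm he hk) oner_eq0.
have [j hj vj] : exists2 j, in_dim p j & inner v (e j) != 0.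
  apply: contrapT => h; case/negP: v0; apply/eqP; apply: (basis_ext he) => j hj.
  by rewrite inner0l; apply/eqP/negPn/negP => h0; apply: h; exists j.
have : b * inner v (e j) = a j * inner v (e j).
  by rewrite -innerZl -hv sA hA// innerZr.
by move=> /(mulIf vj) ->; exact: ha.
Qed.

(* A homogeneous linear system with fewer equations than unknowns. *)
Lemma exists_orthogonal_comb e f m : orthonormal_basis p e -> in_dim p m.+1 ->
  exists x, [/\ x != 0, forall k, (0 < k <= m)%N -> inner x (f k) = 0 &
    forall k, in_dim p k -> (m.+1 < k)%N -> inner x (e k) = 0].
Proof.
move=> he hm.
pose M : 'M[R]_(m.+1, m) := \matrix_(i, j) inner (e i.+1) (f j.+1).
(* With [m.+1] rows and [m] columns the left kernel is nonzero; a nonzero row of it gives the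
   coefficients of [x]. *)
have : kermx M != 0.
  rewrite kermx_eq0; apply/negP => /eqP rM.
  by have := rank_leq_col M; rewrite rM ltnn.
case/matrix0Pn => i [j hij].
pose a k := kermx M i (inord k.-1).
pose x := \sum_(1 <= k < m.+2) a k *: e k.
have xE : x = \sum_(l < m.+1) kermx M i l *: e l.+1.
  rewrite /x big_add1 /= big_mkord; apply: eq_bigr => l _.
  by rewrite /a /= inord_val.
exists x; split.
- apply: contra_neq hij => x0; have := inner_onb_sum he m.+2 a (k := j.+1).
  rewrite -(big_in_dim _ hm) -/x x0 inner0l ltnS ltn_ord /a /= inord_val => ->//.
  by apply: (in_dimW _ hm); rewrite /= ltn_ord.
- case=> [|k] //= km; rewrite xE inner_suml.
  have : (kermx M *m M) i (Ordinal km) = 0 by rewrite mulmx_ker mxE.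
  rewrite mxE => hM; transitivity (\sum_(l < m.+1) kermx M i l * M l (Ordinal km)) => //.
  apply: eq_bigr => l _.
  by rewrite innerZl [M _ _]mxE.
- move=> k hk mk; rewrite /x (big_in_dim _ hm) (inner_onb_sum he)//.
  by rewrite ltnNge mk.
Qed.

(** One form for two operators on the leading eigenspace: weights lam_j^(-1/2) give the whitening
    map, weights lam_j^(1/2) the square root of the covariance. *)
Definition diag_le e a d x : H := \sum_(1 <= j < d.+1) (a j * inner x (e j)) *: e j.

Lemma diag_le_sym e a d : sym_op (diag_le e a d).
Proof.
move=> x y; rewrite inner_suml inner_sumr; apply: eq_bigr => j _.
by rewrite innerZl innerZr (innerC (e j)) mulrAC.
Qed.

Lemma inner_diag_le e a d x k : orthonormal_basis p e -> in_dim p d ->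
  in_dim p k -> inner (diag_le e a d x) (e k) =
  if (k <= d)%N then a k * inner x (e k) else 0.
Proof.
by move=> he hd hk; rewrite /diag_le (big_in_dim _ hd) (inner_onb_sum he)// ltnS.
Qed.

Lemma sqnorm_diag_le e a d x : orthonormal_basis p e -> in_dim p d ->
  `|diag_le e a d x| ^+ 2 = \sum_(1 <= j < d.+1) a j ^+ 2 * inner x (e j) ^+ 2.
Proof.
move=> he hd; rewrite /diag_le (big_in_dim _ hd) (sqnorm_onb_sum he).
by rewrite [RHS](big_in_dim _ hd); apply: eq_bigr => j _; rewrite exprMn.
Qed.

Lemma inner_sq_le e x k : orthonormal_basis p e -> in_dim p k ->
  inner x (e k) ^+ 2 <= `|x| ^+ 2.
Proof.
move=> he hk; rewrite -(@real_normK _ (inner x (e k))) ?num_real//.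
rewrite lerXn2r// ?nnegrE//; apply: le_trans (cauchy_schwarz _ _) _.
suff -> : `|e k| = 1 by rewrite mulr1.
by apply/eqP; rewrite -sqrp_eq1// (onb_norm he).
Qed.

(** Cruder than the largest weight, but any finite constant makes conjugation by this operator
    admissible. *)
Lemma norm_diag_le e a d x : orthonormal_basis p e -> in_dim p d ->
  `|diag_le e a d x| <= Num.sqrt (\sum_(1 <= j < d.+1) a j ^+ 2) * `|x|.
Proof.
move=> he hd; rewrite -(@ler_pXn2r _ 2)// ?nnegrE ?mulr_ge0// exprMn.
rewrite sqr_sqrtr ?sumr_ge0// => [|j _]; last exact: sqr_ge0.
rewrite (sqnorm_diag_le _ _ he hd) mulr_suml [leLHS](big_in_dim _ hd).
rewrite [leRHS](big_in_dim _ hd); apply: ler_sum => j hj.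
by rewrite ler_wpM2l ?sqr_ge0// (inner_sq_le _ he).
Qed.

Lemma diag_le_basis e a d k : orthonormal_basis p e -> in_dim p d ->
  in_dim p k -> diag_le e a d (e k) = if (k <= d)%N then a k *: e k else 0.
Proof.
move=> he hd hk; apply: (basis_ext he) => j hj; rewrite inner_diag_le//.
case: he => o _; rewrite o//; have [<-|kj] := eqVneq k j.
  by case: ifP; rewrite ?inner0l// innerZl o// eqxx.
by case: ifP; case: ifP; rewrite ?inner0l ?mulr0// innerZl o// (negbTE kj) mulr0.
Qed.

Lemma proj_gt_basis e d k : orthonormal_basis p e -> in_dim p d -> in_dim p k ->
  proj_gt e d (e k) = if (k <= d)%N then 0 else e k.
Proof.
move=> he hd hk; apply: (basis_ext he) => j hj; rewrite (inner_proj_gt he)//.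
case: he => o _; rewrite o//; have [<-|kj] := eqVneq k j.
  by case: ifP; rewrite ?inner0l// o// eqxx.
by case: ifP; case: ifP; rewrite ?inner0l// o// (negbTE kj).
Qed.

Lemma norm_proj_gt_le e d x : orthonormal_basis p e -> in_dim p d ->
  `|proj_gt e d x| <= `|x|.
Proof.
move=> he hd; rewrite -(@ler_pXn2r _ 2)// ?nnegrE//.
by rewrite (sqnorm_proj_gt he)// gerBl sqr_ge0.
Qed.

Lemma norm_proj_le_le e d x : orthonormal_basis p e -> in_dim p d ->
  `|proj_le e d x| <= `|x|.
Proof.
move=> he hd; rewrite -(@ler_pXn2r _ 2)// ?nnegrE//.
by rewrite -subr_ge0 -(sqnorm_proj_gt he)// sqr_ge0.
Qed.

(** * Perturbation of eigenvalues and eigenprojections *)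

Section Perturbation.
Context {S B : H -> H} {lam h : nat -> R} {u v : nat -> H} {d : nat}.
Hypotheses (sS : sym_op S) (sB : sym_op B)
  (hS : spectral_decomposition p S lam u)
  (hB : spectral_decomposition p B h v) (hd1 : in_dim p d.+1).

(** Some nonzero [x] in the span of v_1, ..., v_(d+1) is orthogonal to u_1, ..., u_d. On it the form
    of [B] is at least h_(d+1), that of [S] at most lam_(d+1), both per unit of squared norm, and
    [proj_gt u d] fixes it. *)
Lemma eigenvalue_upper (t : R) : 0 <= t ->
  ~ (t%:E < op_norm (sub_op (proj_gt u d \o S \o proj_gt u d)
                           (proj_gt u d \o B \o proj_gt u d)))%E ->
  h d.+1 <= lam d.+1 + t.
Proof.
move=> t0 ht; have [hu hSu mS] := hS; have [hv hBv mB] := hB.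
have [x [x0 xu xv]] := exists_orthogonal_comb u hv hd1.
have sP : sym_op (proj_gt u d) by move=> y z; exact: proj_gt_sym.
have sC : sym_op (sub_op (proj_gt u d \o S \o proj_gt u d)
                           (proj_gt u d \o B \o proj_gt u d)).
  by apply: sym_sub_op; apply: sym_conj.
have := op_norm_le_quad x sC t0 ht.
have Px : proj_gt u d x = x.
  rewrite /proj_gt /proj_le big_nat_cond big1 ?subr0// => j.
  by rewrite andbT ltnS => hj; rewrite /proj /tensor innerC xu ?scale0r.
rewrite /sub_op /= innerBl !sP !Px => /ler_normlP[/[swap] _ hx].
have hBx : h d.+1 * `|x| ^+ 2 <= inner (B x) x.
  apply: (quad_ge hv sB hBv) => j hj; have [jd _|jd] := leqP j d.+1; first exact: mB.
  by rewrite xv// eqxx.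
have hSx : inner (S x) x <= lam d.+1 * `|x| ^+ 2.
  apply: (quad_le hu sS hSu) => j hj; have [jd|jd _] := leqP j d; last exact: mS.
  by rewrite xu ?eqxx// jd andbT; case/andP: hj.
have nx : 0 < `|x| ^+ 2 by rewrite exprn_gt0// normr_gt0.
by rewrite -(ler_pM2r nx); lra.
Qed.

(** S^(-1/2) on the span of the first [d] eigenvectors and 0 on its complement; conjugation turns
    [S] into the projection onto that span. *)
Definition whiten : H -> H := diag_le u (fun j => (Num.sqrt (lam j))^-1) d.

Lemma whiten_conj_basis k : (forall j, in_dim p j -> 0 < lam j) -> in_dim p k ->
  (whiten \o S \o whiten) (u k) = (if (k <= d)%N then 1 else 0) *: u k.
Proof.
move=> lam0 hk; have [hu hSu mS] := hS.
have hd : (0 < d)%N -> in_dim p d by move=> d0; apply: (in_dimW _ hd1); rewrite d0 leqnSn.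
(* For [d] = 0 the condition [in_dim p d] fails and the operator is an empty sum. *)
have [d0|d0] := posnP d.
  have -> : whiten = fun=> 0 by apply/funext => y; rewrite /whiten /diag_le d0 big_geq.
  rewrite /= d0.
  by rewrite leqNgt; case/andP: hk => -> _ /=; rewrite scale0r.
have sL : sym_op whiten by exact: diag_le_sym.
rewrite /= [X in whiten (S X)]diag_le_basis ?hd//; case: ifP => kd.
  rewrite (sym_opZ sS) hSu// !(sym_opZ sL) [whiten _]diag_le_basis ?hd// kd.
  rewrite !scalerA; congr (_ *: _); rewrite mulrAC -invfM -expr2 sqr_sqrtr ?ltW ?lam0//.
  by rewrite mulVf// gt_eqF// lam0.
by rewrite (sym_op0 sS) (sym_op0 sL) scale0r.
Qed.

(** Take [x] in the span of u_1, ..., u_d orthogonal to v_1, ..., v_(d-1), and y = S^(1/2) x, so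
    that whitening maps [y] to [x]. The error at [x] is then at most t |y|^2 = t <S x, x>, hence <B
    x, x> >= (1 - t) <S x, x>. *)
Lemma eigenvalue_lower (t : R) : (0 < d)%N -> (forall j, in_dim p j -> 0 < lam j) ->
  0 <= t <= 1 ->
  ~ (t%:E < op_norm (sub_op (whiten \o S \o whiten) (whiten \o B \o whiten)))%E ->
  (1 - t) * lam d <= h d.
Proof.
move=> d0 lam0 /andP[t0 t1] ht; have [hu hSu mS] := hS; have [hv hBv mB] := hB.
have hd : in_dim p d by apply: (in_dimW _ hd1); rewrite d0 leqnSn.
have hd' : in_dim p d.-1.+1 by rewrite prednK.
have [x [x0 xv xu]] := exists_orthogonal_comb v hu hd'.
rewrite prednK// in xu.
have sL : sym_op whiten by exact: diag_le_sym.
have sC : sym_op (sub_op (whiten \o S \o whiten) (whiten \o B \o whiten)).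
  by apply: sym_sub_op; apply: sym_conj.
pose y := diag_le u (fun j => Num.sqrt (lam j)) d x.
have sq k : in_dim p k -> Num.sqrt (lam k) != 0.
  by move=> hk; rewrite gt_eqF// sqrtr_gt0 lam0.
have Ly : whiten y = x.
  apply: (basis_ext hu) => k hk; rewrite !inner_diag_le//.
  by have [kd|kd] := leqP k d; [rewrite mulKf ?sq | rewrite xu].
have Sxx : inner (S x) x = `|y| ^+ 2.
  rewrite normr_inner -[X in inner _ X = _]Ly -sL; congr inner.
  apply: (basis_ext hu) => k hk; rewrite !inner_diag_le//; case: ifP => // _.
  rewrite sS hSu// innerZr mulrA; congr (_ * _).
  by rewrite -[X in _ * X](@sqr_sqrtr _ (lam k)) ?ltW ?lam0// expr2 mulKf ?sq.
have := op_norm_le_quad y sC t0 ht.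
rewrite /sub_op /= innerBl !sL Ly Sxx => /ler_normlP[_ hy].
have hSx : lam d * `|x| ^+ 2 <= inner (S x) x.
  apply: (quad_ge hu sS hSu) => j hj; have [jd _|jd] := leqP j d; first exact: mS.
  by rewrite xu ?eqxx.
have hBx : inner (B x) x <= h d * `|x| ^+ 2.
  apply: (quad_le hv sB hBv) => j hj; have [dj _|jd] := leqP d j; first exact: mB.
  rewrite xv ?eqxx//; case/andP: (hj) => -> _ /=.
  by rewrite -ltnS prednK.
have nx : 0 < `|x| ^+ 2 by rewrite exprn_gt0// normr_gt0.
rewrite -(ler_pM2r nx) (le_trans _ hBx)// -mulrA.
apply: (@le_trans _ _ ((1 - t) * inner (S x) x)); last by rewrite Sxx; lra.
by rewrite ler_wpM2l// subr_ge0.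
Qed.

(** Compare coordinates along the v_k: for k > d the factor lam_j - h_k is at least lam_j - h_(d+1)
    >= g; the other coordinates of the projection vanish. *)
Lemma sqnorm_proj_gt_bound j (g : R) : in_dim p d -> in_dim p j -> 0 <= g ->
  h d.+1 + g <= lam j ->
  g ^+ 2 * `|proj_gt v d (u j)| ^+ 2 <= `|sub_op S B (u j)| ^+ 2.
Proof.
move=> hd hj g0 hg; have [hu hSu mS] := hS; have [hv hBv mB] := hB.
rewrite -sqnormZ; apply: (sqnorm_le_basis hv) => k hk.
rewrite /sub_op innerBl hSu// innerZl sB hBv// innerZl innerZr -mulrBl.
rewrite (inner_proj_gt hv)//; have [kd|dk] := leqP k d.
  by rewrite mulr0 expr0n sqr_ge0.
rewrite !exprMn ler_wpM2r ?sqr_ge0// lerXn2r// ?nnegrE.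
  by have := mB _ _ hd1 hk dk; lra.
by have := mB _ _ hd1 hk dk; lra.
Qed.

Lemma sqnorm_proj_le_bound j (g : R) : in_dim p d -> in_dim p j -> 0 <= g ->
  lam j + g <= h d ->
  g ^+ 2 * `|proj_le v d (u j)| ^+ 2 <= `|sub_op S B (u j)| ^+ 2.
Proof.
move=> hd hj g0 hg; have [hu hSu mS] := hS; have [hv hBv mB] := hB.
rewrite -sqnormZ; apply: (sqnorm_le_basis hv) => k hk.
rewrite /sub_op innerBl hSu// innerZl sB hBv// innerZl innerZr -mulrBl.
rewrite (inner_proj_le hv)//; have [kd|dk] := leqP k d; last first.
  by rewrite mulr0 expr0n sqr_ge0.
(* Now h_k - lam_j >= g for k <= d, so the factor is negated before squares are compared. *)
rewrite !exprMn ler_wpM2r ?sqr_ge0// -[leRHS]sqrrN opprB lerXn2r// ?nnegrE.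
  by have := mB _ _ hk hd kd; lra.
by have := mB _ _ hk hd kd; lra.
Qed.

End Perturbation.

End Spectral.
Arguments whiten {R H} lam u d x.

(* [Q] collects the indices of the largest weights, [tau] is a threshold. *)
Lemma knapsack (R : realFieldType) (r : seq nat) (Q : pred nat)
    (w a : nat -> R) (tau : R) :
  (forall j, j \in r -> 0 <= a j <= 1) ->
  (forall j, j \in r -> if Q j then tau <= w j else w j <= tau) ->
  tau * \sum_(j <- r) a j <= tau * (count Q r)%:R ->
  \sum_(j <- r) w j * a j <= \sum_(j <- r | Q j) w j.
Proof.
move=> ha hw ht.
(* The excess over the threshold is kept only on [Q], where it is nonnegative and [a j] is at most
   1. *)
apply: (@le_trans _ _ (\sum_(j <- r) (tau * a j + if Q j then w j - tau else 0))).
  rewrite big_seq [leRHS]big_seq; apply: ler_sum => j jr.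
  have /andP[a0 a1] := ha j jr; have := hw j jr; case: ifP => _ h.
    have : (w j - tau) * a j <= w j - tau by rewrite ler_piMr// subr_ge0.
    lra.
  by rewrite addr0 ler_wpM2r.
rewrite big_split/= -mulr_sumr -big_mkcond/= sumrB.
rewrite (le_trans (lerD ht (lexx _)))//.
by rewrite big_const_seq iter_addr addr0 mulr_natr addrC subrK.
Qed.

(** * Termwise integration of nonnegative series *)

Lemma integral_nneseries_cond d (T : measurableType d) (R : realType)
    (mu : {measure set T -> \bar R}) (f : nat -> T -> \bar R) (Q : pred nat) N :
  (forall i, Q i -> measurable_fun setT (f i)) -> (forall i w, 0 <= f i w)%E ->
  (\int[mu]_w (\sum_(N <= i <oo | Q i) f i w) =
   \sum_(N <= i <oo | Q i) \int[mu]_w f i w)%E.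
Proof.
move=> mf f0; rewrite ereal_series_cond eseries_mkcond.
transitivity (\int[mu]_w \sum_(i <oo) if (N <= i)%N && Q i then f i w else 0)%E.
  by apply: eq_integral => w _; rewrite ereal_series_cond eseries_mkcond.
rewrite integral_nneseries//.
- apply: eq_eseriesr => i _; case: ifP => // _; exact: integral0.
- by move=> i; case: (boolP ((N <= i)%N && Q i)) => // /andP[_]; exact: mf.
- by move=> i w _; case: ifP.
Qed.

Lemma measurable_nneseries_cond d (T : measurableType d) (R : realType)
    (f : nat -> T -> \bar R) (Q : pred nat) N :
  (forall i, Q i -> measurable_fun setT (f i)) -> (forall i w, 0 <= f i w)%E ->
  measurable_fun setT (fun w => \sum_(N <= i <oo | Q i) f i w)%E.
Proof.
move=> mf f0; rewrite (_ : (fun w => _) =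
    fun w => (\sum_(0 <= i <oo | (N <= i)%N && Q i) f i w)%E); last first.
  by apply/funext => w; rewrite ereal_series_cond.
by apply: ge0_emeasurable_sum => // i /andP[_]; exact: mf.
Qed.

(** * Second moments of the covariance error *)

Section Moments.
Context {R : realType} {H : hilbertType R} {disp : measure_display}
  {T : measurableType disp} {P : probability T R}.
Context {p : option nat} {u : nat -> H} {lam : nat -> R} {X : T -> H} {S : H -> H}
  {n : nat} {Xs : 'I_n -> T -> H}.
Hypotheses (hX : random_vector X) (hX2 : square_integrable P X)
  (hS : covariance_operator P X S) (n1 : (1 <= n)%N)
  (hXs : independent_copies P X Xs) (hu : spectral_decomposition p S lam u).

Lemma trace_eigenvalues : (trace p u S = \sum_(1 <= i <oo | in_dim p i) (lam i)%:E)%E.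
Proof.
have [h hSu _] := hu; apply: eq_eseriesr => i hi.
by rewrite hSu// innerZl -normr_inner (onb_norm h)// mulr1.
Qed.

(** Parseval and termwise integration identify the trace with E|X|^2. *)
Lemma trace_lty : (trace p u S < +oo)%E.
Proof.
have [h _ _] := hu; suff -> : trace p u S = (\int[P]_w (`|X w| ^+ 2)%:E)%E by [].
under eq_integral do rewrite -(parseval h).
rewrite integral_nneseries_cond.
- by apply: eq_eseriesr => i _; rewrite -(covariance_operatorE _ _ hS).
- move=> i _; apply/measurable_EFinP; apply: measurable_funX; exact: measurable_inner.
- by move=> i w; rewrite lee_fin sqr_ge0.
Qed.

Definition deviation w : H -> H := sub_op S (sample_covariance Xs w).

Lemma deviation_sym w : sym_op (deviation w).
Proof.
apply: sym_sub_op; first exact: covariance_operator_sym hS.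
exact: sample_covariance_sym.
Qed.

Lemma measurable_inner_deviation x y :
  measurable_fun setT (fun w => inner (deviation w x) y).
Proof.
rewrite /deviation /sub_op; under eq_fun do rewrite innerBl.
apply: measurable_funB => //.
by case: hXs => hrv _ _; exact: measurable_inner_sample_covariance.
Qed.

Lemma measurable_sqnorm_deviation x :
  measurable_fun setT (fun w => (`|deviation w x| ^+ 2)%:E).
Proof.
have [h _ _] := hu; under eq_fun do rewrite -(parseval h).
apply: measurable_nneseries_cond => [i _|i w]; last by rewrite lee_fin sqr_ge0.
apply/measurable_EFinP; apply: measurable_funX; exact: measurable_inner_deviation.
Qed.

(** Parseval splits the squared norm into squared entries; summing their bounds over k, with delta
    <= 2, produces the trace and the factor 2. *)
Lemma second_moment_deviation C2 j : (forall j, in_dim p j -> 0 <= lam j) ->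
  0 <= C2 -> second_moment_bound p lam u P S Xs C2 -> in_dim p j ->
  (\int[P]_w (`|deviation w (u j)| ^+ 2)%:E <=
   (2 * C2 * lam j / n%:R)%:E * trace p u S)%E.
Proof.
move=> lam0 C20 hC2 hj; have [h _ _] := hu.
under eq_integral do rewrite -(parseval h).
rewrite integral_nneseries_cond; last 2 first.
- move=> i _; apply/measurable_EFinP; apply: measurable_funX.
  exact: measurable_inner_deviation.
- by move=> i w; rewrite lee_fin sqr_ge0.
rewrite trace_eigenvalues -nneseriesZl => [|i hi]; last by rewrite lee_fin lam0.
rewrite ereal_series_cond [leRHS]ereal_series_cond.
apply: lee_nneseries => k; first by move=> _ _; apply: integral_ge0 => w _; rewrite lee_fin sqr_ge0.
move=> /andP[_ hk]; apply: le_trans (le_trans (hC2 k j hk hj) _).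
  apply: le_integral_ge0 => w; first by rewrite lee_fin sqr_ge0.
  by rewrite (hs_norm_sq_proj2 h)//; exact: sym_opZ (deviation_sym w).
rewrite -EFinM lee_fin.
have c0 : 0 <= C2 * lam j / n%:R * lam k by rewrite !mulr_ge0 ?lam0// invr_ge0.
rewrite -subr_ge0; case: ifP => _; last by lra.
by rewrite le_eqVlt; apply/orP; left; apply/eqP; ring.
Qed.

(** The majorant is the squared deviation over g^2 plus the indicator of [D]; it is measurable
    whether or not [a] is. *)
Lemma dominated_by_deviation C2 j (D : set T) (a : T -> R) (g b : R) :
  (forall j, in_dim p j -> 0 <= lam j) ->
  0 <= C2 -> second_moment_bound p lam u P S Xs C2 -> in_dim p j ->
  measurable D -> (P D <= b%:E)%E -> 0 < g -> (forall w, 0 <= a w <= 1) ->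
  (forall w, ~ D w -> g ^+ 2 * a w <= `|deviation w (u j)| ^+ 2) ->
  exists F : T -> \bar R, [/\ measurable_fun setT F, forall w, (0 <= F w)%E,
    forall w, ((a w)%:E <= F w)%E &
    (\int[P]_w F w <= (2 * C2 * lam j / (n%:R * g ^+ 2))%:E * trace p u S + b%:E)%E].
Proof.
move=> lam0 C20 hC2 hj mD PD g0 a01 hD.
have g20 : 0 < g ^+ 2 by rewrite exprn_gt0.
have mdev := measurable_sqnorm_deviation (u j).
have dev0 w : (0 <= (`|deviation w (u j)| ^+ 2)%:E :> \bar R)%E.
  by rewrite lee_fin sqr_ge0.
have ig0 : (0 <= ((g ^+ 2)^-1)%:E :> \bar R)%E by rewrite lee_fin invr_ge0 ltW.
pose F w := (((g ^+ 2)^-1)%:E * (`|deviation w (u j)| ^+ 2)%:E + (\1_D w)%:E)%E.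
exists F; split.
- apply: emeasurable_funD; last by apply/measurable_EFinP; exact: measurable_indic.
  by apply: measurable_funeM.
- by move=> w; rewrite adde_ge0// ?mule_ge0// lee_fin indicE.
- move=> w; rewrite /F -EFinM -EFinD lee_fin indicE; have /andP[a0 a1] := a01 w.
  have [wD|wD] := pselect (D w).
    by rewrite mem_set// (le_trans a1)// lerDr -lee_fin EFinM mule_ge0.
  by rewrite memNset// addr0 ler_pdivlMl// hD.
rewrite ge0_integralD//; last 3 first.
- by move=> w _; rewrite mule_ge0.
- exact: measurable_funeM.
- by apply/measurable_EFinP; exact: measurable_indic.
rewrite integral_indic// setIT leeD// ge0_integralZl//.
apply: le_trans (lee_wpmul2l ig0 (second_moment_deviation lam0 C20 hC2 hj)) _.
rewrite muleA -EFinM.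
suff -> : (g ^+ 2)^-1 * (2 * C2 * lam j / n%:R) = 2 * C2 * lam j / (n%:R * g ^+ 2) by [].
by rewrite [in RHS]invfM [RHS]mulrA [LHS]mulrC.
Qed.

End Moments.

(** * Total mass of the empirical projections and the knapsack bounds *)

Section ProjectionSums.
Context {R : realType} {H : hilbertType R} {p : option nat} {u v : nat -> H} {d : nat}.
Hypotheses (hu : orthonormal_basis p u) (hv : orthonormal_basis p v)
  (hd : in_dim p d).

Lemma sqnorm_proj_le_01 j : in_dim p j -> 0 <= `|proj_le v d (u j)| ^+ 2 <= 1.
Proof.
move=> hj; rewrite sqr_ge0 -(onb_norm hu hj) lerXn2r// ?nnegrE//.
exact: norm_proj_le_le hv hd.
Qed.

Lemma sqnorm_proj_gt_01 j : in_dim p j -> 0 <= `|proj_gt v d (u j)| ^+ 2 <= 1.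
Proof.
move=> hj; rewrite sqr_ge0 -(onb_norm hu hj) lerXn2r// ?nnegrE//.
exact: norm_proj_gt_le hv hd.
Qed.

(** Exchanging the sums leaves, for each i <= d, a Bessel sum of v_i in the basis [u], at most 1. *)
Lemma sum_sqnorm_proj_le m :
  \sum_(1 <= k < m | in_dim p k) `|proj_le v d (u k)| ^+ 2 <= d%:R.
Proof.
under eq_bigr do rewrite (sqnorm_proj_le hv _ hd).
rewrite exchange_big/=.
apply: (@le_trans _ _ (\sum_(1 <= k < d.+1) 1)); last first.
  by rewrite big_const_nat iter_addr addr0 subn1.
rewrite big_nat [leRHS]big_nat; apply: ler_sum => i /andP[i0 id].
have hi : in_dim p i by apply: (in_dimW _ hd); rewrite i0.
under eq_bigr do rewrite innerC.
by rewrite -(onb_norm hv hi); exact: bessel.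
Qed.

(** The trace of a projection of rank q - d, computed in the basis [u]. *)
Lemma sum_sqnorm_proj_gt q : p = Some q ->
  \sum_(1 <= k < q.+1) `|proj_gt v d (u k)| ^+ 2 = (q - d)%:R.
Proof.
move=> pq; have dq : (d <= q)%N by move: hd; rewrite pq => /andP[].
have hq : in_dim p q.
  by rewrite pq /in_dim leqnn andbT (leq_trans _ dq)//; case/andP: hd.
have h k : in_dim p k -> `|proj_gt v d (u k)| ^+ 2 =
    1 - \sum_(1 <= i < d.+1) inner (u k) (v i) ^+ 2.
  by move=> hk; rewrite (sqnorm_proj_gt hv)// (onb_norm hu hk) (sqnorm_proj_le hv).
rewrite (big_in_dim _ hq) (eq_bigr _ (fun k hk => h k hk)) sumrB exchange_big/=.
rewrite -!(big_in_dim _ hq) big_const_nat iter_addr addr0 subn1/= natrB//.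
congr (_ - _).
transitivity (\sum_(1 <= k < d.+1) (1 : R)); last first.
  by rewrite big_const_nat iter_addr addr0 subn1.
rewrite big_nat [RHS]big_nat; apply: eq_bigr => i /andP[i0 id].
have hi : in_dim p i by apply: (in_dimW _ hd); rewrite i0.
rewrite -(onb_norm hv hi) -(big_in_dim _ hq).
under eq_bigr do rewrite innerC.
rewrite -(sqnorm_proj_le hu _ hq); congr (`|_| ^+ 2).
(* In dimension [q] the projection onto the first [q] basis vectors is the identity. *)
apply: (basis_ext hu) => k hk; rewrite (inner_proj_le hu)//.
by case: leqP => // qk; move: hk; rewrite pq => /andP[_]; rewrite leqNgt qk.
Qed.

Lemma weighted_sum_proj_gt (w : nat -> R) r : (r <= d)%N ->
  (forall i j, (0 < i)%N -> (i <= j <= d)%N -> w j <= w i) ->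
  (forall j, (0 < j <= d)%N -> 0 <= w j) ->
  \sum_(r.+1 <= j < d.+1) w j * `|proj_gt v d (u j)| ^+ 2 <=
  \sum_(r.+1 <= j < (upper_index p d r).+1) w j.
Proof.
move=> rd wmon w0.
have inr j : j \in index_iota r.+1 d.+1 -> (0 < j <= d)%N /\ in_dim p j.
  rewrite mem_index_iota ltnS => /andP[rj jd].
  have hj : (0 < j <= d)%N by rewrite (leq_ltn_trans _ rj).
  by split => //; exact: in_dimW hd.
pose c := upper_index p d r.
have cd : (c <= d)%N by rewrite /c /upper_index; case: (p) => // q; exact: geq_minl.
rewrite -/c [leRHS](big_nat_widen _ _ d.+1) ?ltnS//=.
(* Indices r+1, ..., c are retained, and the threshold is the first weight left out. When c = d
   nothing is left out, and the threshold 0 trivializes the mass constraint. *)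
apply: (knapsack (a := fun j => `|proj_gt v d (u j)| ^+ 2)
  (Q := fun j => (j < c.+1)%N) (tau := if c == d then 0 else w c.+1)) => [j /inr[_ hj]|j jr|].
- exact: sqnorm_proj_gt_01.
- have [/andP[j0 jd] _] := inr j jr; have [cdE|ncd] := eqVneq c d.
    by rewrite cdE ltnS jd w0// j0.
  have cd' : (c < d)%N by rewrite ltn_neqAle ncd.
  by rewrite ltnS; case: leqP => jc; apply: wmon => //; lia.
have [cdE|ncd] := eqVneq c d; first by rewrite !mul0r.
have cd' : (c < d)%N by rewrite ltn_neqAle ncd.
apply: ler_wpM2l; first by apply: w0; rewrite /=.
case pE : p => [q|]; last by move: ncd; rewrite /c /upper_index pE eqxx.
have cE : c = (r + q - d)%N.
  by move: ncd; rewrite /c /upper_index pE /minn; case: ifP; rewrite ?eqxx.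
have dq : (d <= q)%N by move: hd; rewrite pE => /andP[].
have -> : count (fun j => (j < c.+1)%N) (index_iota r.+1 d.+1) = (q - d)%N.
  rewrite -sum1_count -(big_nat_widen _ _ _ xpredT)// sum_nat_const_nat muln1 cE.
  by lia.
rewrite -(sum_sqnorm_proj_gt pE) [leRHS](big_cat_nat _ (n := r.+1))//=; last by lia.
rewrite [X in _ + X](big_cat_nat _ (n := d.+1))//=.
have s0 a b : 0 <= \sum_(a <= j < b) `|proj_gt v d (u j)| ^+ 2.
  by apply: sumr_ge0 => j _; exact: sqr_ge0.
by rewrite addrCA lerDl addr_ge0.
Qed.

Lemma weighted_sum_proj_le (w : nat -> R) m : (d < m)%N ->
  (forall k, (d < k < m)%N -> in_dim p k) ->
  (forall i j, (d < i)%N -> (i <= j < m)%N -> w i <= w j) ->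
  (forall j, (d < j < m)%N -> 0 <= w j) ->
  \sum_(d.+1 <= j < m) w j * `|proj_le v d (u j)| ^+ 2 <=
  \sum_(maxn d.+1 (m - d) <= j < m) w j.
Proof.
move=> dm inm wmon w0.
pose c := maxn d.+1 (m - d).
have dc : (d < c)%N by exact: leq_maxl.
rewrite -/c [leRHS](big_nat_widenl _ d.+1)//=.
(* The weights now increase, so the last [d] indices are retained and the threshold is [w c.-1]; if
   c = d+1 all are retained and the threshold is 0. *)
apply: (knapsack (a := fun j => `|proj_le v d (u j)| ^+ 2)
  (Q := fun j => (c <= j)%N) (tau := if c == d.+1 then 0 else w c.-1)) => [j|j|].
- by rewrite mem_index_iota => /inm; exact: sqnorm_proj_le_01.
- rewrite mem_index_iota => /andP[dj jm]; have [cdE|ncd] := eqVneq c d.+1.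
    by rewrite cdE dj w0// dj.
  have cd' : (d.+1 < c)%N by rewrite ltn_neqAle eq_sym ncd.
  by case: leqP => jc; apply: wmon => //; lia.
have [cdE|ncd] := eqVneq c d.+1; first by rewrite !mul0r.
have cE : c = (m - d)%N by move: ncd; rewrite /c; lia.
apply: ler_wpM2l; first by apply: w0; lia.
have -> : count (fun j => (c <= j)%N) (index_iota d.+1 m) = d.
  rewrite -sum1_count -(big_nat_widenl _ _ _ xpredT)// sum_nat_const_nat muln1 cE.
  by lia.
apply: le_trans (sum_sqnorm_proj_le m).
rewrite [leRHS]big_mkcond [leRHS](big_cat_nat _ (n := d.+1))//=.
rewrite -[leLHS]add0r lerD//.
  by apply: sumr_ge0 => j _; case: ifP => // _; exact: sqr_ge0.
rewrite big_nat [leRHS]big_nat; apply: ler_sum => j dj.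
by rewrite inm.
Qed.

End ProjectionSums.

(** * Tail bounds and measurable majorants for single summands *)

Section Dominators.
Context {R : realType} {H : hilbertType R} {p : option nat}
    {disp : measure_display} {T : measurableType disp} {P : probability T R}
    {X : T -> H} {Sigma : H -> H} {lam : nat -> R} {u : nat -> H}
    {n : nat} {Xs : 'I_n -> T -> H}
    {hlam : T -> nat -> R} {hu : T -> nat -> H}
    {d : nat} {C1 C2 C3 mu : R}.
Hypotheses (X_rv : random_vector X)
    (X_centered : has_mean P X 0)
    (X_L2 : square_integrable P X)
    (X_cov : covariance_operator P X Sigma)
    (Sigma_spectral : spectral_decomposition p Sigma lam u)
    (lam_gt0 : forall j, in_dim p j -> 0 < lam j)
    (n_ge1 : (1 <= n)%N)
    (Xs_copies : independent_copies P X Xs)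
    (hSigma_spectral : forall w,
      spectral_decomposition p (sample_covariance Xs w) (hlam w) (hu w))
    (d_ge1 : (1 <= d)%N)
    (d_ltp : in_dim p d.+1)
    (C2_ge0 : 0 <= C2)
    (C2_bound : second_moment_bound p lam u P Sigma Xs C2)
    (C3_gt1 : 1 < C3)
    (C3_def : koltchinskii_lounici C1 C3)
    (X_subgaussian : sub_gaussian P C1 X)
    (mu_range : lam d.+1 <= mu <= lam d).

Local Notation tr := (fine (trace p u Sigma)).
Local Notation C := (8 * C2 + 8 * C3 ^+ 2).

Lemma in_dim_d : in_dim p d.
Proof. by apply: (in_dimW _ d_ltp); rewrite d_ge1 leqnSn. Qed.

Lemma trace_fineE : trace p u Sigma = tr%:E.
Proof.
rewrite fineK// fin_real// (trace_lty X_rv X_L2 X_cov Sigma_spectral) andbT.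
rewrite (trace_eigenvalues Sigma_spectral) (lt_le_trans (ltNyr 0))//.
by apply: nneseries_ge0 => i _ hi; rewrite lee_fin ltW// lam_gt0.
Qed.

Lemma sum_eigenvalues_le_trace m : \sum_(1 <= i < m | in_dim p i) lam i <= tr.
Proof.
rewrite -lee_fin -trace_fineE (trace_eigenvalues Sigma_spectral) -sumEFin.
by apply: nneseries_lim_ge => i _ hi; rewrite lee_fin ltW// lam_gt0.
Qed.

Lemma eigenvalue_le_trace j : in_dim p j -> lam j <= tr.
Proof.
move=> hj; apply: le_trans (sum_eigenvalues_le_trace j.+1).
rewrite big_mkcond big_nat_recr/=; last by case/andP: hj.
rewrite hj lerDr; apply: sumr_ge0 => i _; case: ifP => // hi.
by rewrite ltW// lam_gt0.
Qed.

(** Lets the trace [d] of the whitened covariance be paid for by the trace of [Sigma]. *)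
Lemma mul_eigenvalue_le_trace : d%:R * lam d <= tr.
Proof.
apply: le_trans (sum_eigenvalues_le_trace d.+1).
rewrite -(big_in_dim _ in_dim_d).
have -> : d%:R * lam d = \sum_(1 <= i < d.+1) lam d.
  by rewrite big_const_nat iter_addr addr0 subn1 mulr_natl.
apply: ler_sum_nat => i /andP[i0 id].
have [_ _ mS] := Sigma_spectral; apply: mS => //; last exact: in_dim_d.
by apply: (in_dimW _ in_dim_d); rewrite i0.
Qed.

Lemma upper_eigenvalue_tail j : in_dim p j -> lam d.+1 < lam j ->
  (P (conj_deviation Sigma Xs (proj_gt u d) ((lam j - lam d.+1) / 2)) <=
   (4 * C3 ^+ 2 * lam j * tr / (n%:R * (lam j - lam d.+1) ^+ 2))%:E)%E.
Proof.
move=> hj hlt; have hd := in_dim_d; have [ou hSu mS] := Sigma_spectral.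
set G := lam j - lam d.+1; set l := lam d.+1.
have G0 : 0 < G by rewrite subr_gt0.
have l0 : 0 < l by exact: lam_gt0.
have C30 : 0 < C3 by exact: lt_trans ltr01 C3_gt1.
have qE : lam j = l + G by rewrite /G /l; lra.
have n0 : 0 < n%:R :> R by rewrite ltr0n.
have symP : sym_op (proj_gt u d) by move=> x y; exact: proj_gt_sym.
have Pc x : `|proj_gt u d x| <= 1 * `|x| by rewrite mul1r; exact: norm_proj_gt_le ou hd.
have sS := covariance_operator_sym X_cov.
have hA k : in_dim p k -> (proj_gt u d \o Sigma \o proj_gt u d) (u k) =
    (if (k <= d)%N then 0 else lam k) *: u k.
  move=> hk; rewrite /= (proj_gt_basis ou)//; case: ifP => kd.
    by rewrite (sym_op0 sS) (sym_op0 symP) scale0r.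
  by rewrite hSu// (sym_opZ symP) (proj_gt_basis ou)// kd.
have hle : largest_eigenvalue (proj_gt u d \o Sigma \o proj_gt u d) l.
  have := largest_eigenvalueP ou (sym_conj symP sS) hA d_ltp.
  rewrite ltnn; apply=> k hk; case: ifP => [_|/negbT]; first exact: ltW.
  by rewrite -ltnNge => dk; exact: mS.
have htr : (trace p u (proj_gt u d \o Sigma \o proj_gt u d) <= tr%:E)%E.
  rewrite -trace_fineE (trace_eigenvalues Sigma_spectral).
  rewrite /trace ereal_series_cond [leRHS]ereal_series_cond.
  apply: lee_nneseries => k => [_|] /andP[_ hk]; rewrite lee_fin hA// innerZl;
    rewrite -normr_inner (onb_norm ou hk) mulr1; case: ifP => // _;
    by rewrite ltW// lam_gt0.
(* [x] solves C3 l x = G / 2, and [K] makes K tr / (n l) the claimed bound. Then K x = 2 C3 (1 + l /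
   G) and K x^2 = 1 + G / l, both at least 1. *)
pose x := G / (2 * C3 * l).
have x0 : 0 < x by rewrite divr_gt0// !mulr_gt0.
pose K := 4 * C3 ^+ 2 * lam j * l / G ^+ 2.
have hK : 0 <= K by rewrite ltW// divr_gt0 ?exprn_gt0// !mulr_gt0 ?exprn_gt0// lam_gt0.
have := conj_deviation_tail ou X_rv X_centered X_subgaussian X_cov n_ge1 Xs_copies
  C3_def symP Pc (ltW C30) hle (_ : 0 < l <= tr) htr x0 hK.
rewrite l0 eigenvalue_le_trace// => /(_ isT).
have -> : C3 * l * x = G / 2 by rewrite /x; field; rewrite !gt_eqF.
have -> : K * tr / (n%:R * l) = 4 * C3 ^+ 2 * lam j * tr / (n%:R * G ^+ 2).
  by rewrite /K; field; rewrite !gt_eqF.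
apply; rewrite /Num.min; case: ifP => _.
  have -> : K * x = 2 * C3 * (1 + l / G).
    by rewrite /K /x qE; field; rewrite !gt_eqF.
  have z0 : 0 < l / G by rewrite divr_gt0.
  have c1 : 1 < C3 := C3_gt1.
  by move: (l / G) z0 => z z0; nra.
have -> : K * x ^+ 2 = 1 + G / l.
  by rewrite /K /x qE; field; rewrite !gt_eqF.
by rewrite lerDl divr_ge0// ltW.
Qed.

Lemma upper_dominator j : (0 < j <= d)%N ->
  exists F : T -> \bar R, [/\ measurable_fun setT F, forall w, (0 <= F w)%E,
    forall w, (((lam j - mu) * `|proj_gt (hu w) d (u j)| ^+ 2)%:E <= F w)%E &
    (\int[P]_w F w <= (C * ((lam j - mu) *
       (lam j / (n%:R * (lam j - lam d.+1) ^+ 2))) * tr)%:E)%E].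
Proof.
move=> jd; have hd := in_dim_d; have hj := in_dimW jd hd.
have [ou hSu mS] := Sigma_spectral; have /andP[mu1 mu2] := mu_range.
have ldj : lam d <= lam j by apply: mS => //; case/andP: jd.
(* Without a gap lam_j = mu = lam_(d+1): the weight vanishes and the zero majorant suffices. *)
have [lj|lj] := leP (lam j) (lam d.+1).
  have -> : lam j = mu by lra.
  exists (fun=> 0%E); split => //.
    by move=> w; rewrite subrr mul0r.
  by rewrite integral0 subrr mul0r mulr0 mul0r.
have G0 : 0 < (lam j - lam d.+1) / 2 by rewrite divr_gt0 ?subr_gt0.
have n0 : 0 < n%:R :> R by rewrite ltr0n.
have symP : sym_op (proj_gt u d) by move=> x y; exact: proj_gt_sym.
have Pc x : `|proj_gt u d x| <= 1 * `|x| by rewrite mul1r; exact: norm_proj_gt_le ou hd.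
have lam_ge0 i : in_dim p i -> 0 <= lam i by move=> hi; rewrite ltW// lam_gt0.
have mD := measurable_conj_deviation ou X_cov Xs_copies symP (ltW G0).
have a01 w : 0 <= `|proj_gt (hu w) d (u j)| ^+ 2 <= 1.
  by have [hv _ _] := hSigma_spectral w; exact: sqnorm_proj_gt_01 ou hv hd _ hj.
have [|F [mF F0 aF iF]] := dominated_by_deviation X_cov Xs_copies Sigma_spectral
    lam_ge0 C2_ge0 C2_bound hj mD (upper_eigenvalue_tail hj lj) G0 a01.
  move=> w wD; apply: (sqnorm_proj_gt_bound _ Sigma_spectral (hSigma_spectral w) d_ltp) => //.
  - exact: sample_covariance_sym.
  - exact: ltW.
  - have := eigenvalue_upper (covariance_operator_sym X_cov)
      (sample_covariance_sym Xs w) Sigma_spectral (hSigma_spectral w) d_ltp (ltW G0) wD.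
    by lra.
have w0 : (0 <= (lam j - mu)%:E)%E by rewrite lee_fin subr_ge0 (le_trans mu2).
exists (fun w => (lam j - mu)%:E * F w)%E; split.
- exact: measurable_funeM.
- by move=> w; rewrite mule_ge0.
- by move=> w; rewrite EFinM lee_wpmul2l.
rewrite ge0_integralZl// (le_trans (lee_wpmul2l w0 iF))// trace_fineE -(EFinM _ tr) -EFinD -EFinM.
have E (a b c e : R) : a * (b * c) * e = b * (a * (c * e)) by ring.
rewrite lee_fin [leRHS]E ler_wpM2l ?subr_ge0 ?(le_trans mu2)//.
set G := lam j - lam d.+1; set q := lam j.
have G0' : 0 < G by rewrite subr_gt0.
(* Squaring half the gap turns 2 C2 into 8 C2; the tail adds 4 C3^2, within the allowed 8 C3^2. *)
have -> : 2 * C2 * q / (n%:R * (G / 2) ^+ 2) * tr +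
    4 * C3 ^+ 2 * q * tr / (n%:R * G ^+ 2) =
    (8 * C2 + 4 * C3 ^+ 2) * (q / (n%:R * G ^+ 2) * tr).
  by field; rewrite !gt_eqF.
rewrite ler_wpM2r//; last by rewrite lerD2l ler_wpM2r ?sqr_ge0// ler_nat.
rewrite mulr_ge0//; first by rewrite divr_ge0 ?lam_ge0// mulr_ge0 ?sqr_ge0// ltW.
exact: le_trans (lam_ge0 _ hj) (eigenvalue_le_trace hj).
Qed.

Local Notation W := (whiten lam u d).

Lemma whiten_sym : sym_op W.
Proof. exact: diag_le_sym. Qed.

Lemma norm_whiten x :
  `|W x| <= Num.sqrt (\sum_(1 <= j < d.+1) (Num.sqrt (lam j))^-1 ^+ 2) * `|x|.
Proof. by have [ou _ _] := Sigma_spectral; exact: norm_diag_le ou in_dim_d. Qed.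

Lemma whiten_basis k : in_dim p k ->
  (W \o Sigma \o W) (u k) = (if (k <= d)%N then 1 else 0) *: u k.
Proof.
exact: (whiten_conj_basis (covariance_operator_sym X_cov) Sigma_spectral d_ltp lam_gt0).
Qed.

Lemma whiten_largest : largest_eigenvalue (W \o Sigma \o W) 1.
Proof.
have [ou _ _] := Sigma_spectral.
have := largest_eigenvalueP ou (sym_conj whiten_sym (covariance_operator_sym X_cov))
  whiten_basis in_dim_d.
by rewrite leqnn; apply=> k _; case: ifP => //; rewrite ler01.
Qed.

Lemma trace_whiten : (trace p u (W \o Sigma \o W) <= (d%:R)%:E)%E.
Proof.
have [ou _ _] := Sigma_spectral.
have -> : trace p u (W \o Sigma \o W) =
    (\sum_(1 <= k <oo | in_dim p k) (if (k <= d)%N then 1 else 0)%:E)%E.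
  apply: eq_eseriesr => k hk; rewrite whiten_basis// innerZl -normr_inner.
  by rewrite (onb_norm ou hk) mulr1.
rewrite (nneseries_split_cond 1 d) => [|k _]; last by rewrite lee_fin; case: ifP.
rewrite [X in (_ + X)%E]eseries0 => [|k]; last first.
  by rewrite add1n ltnNge => /negbTE ->.
rewrite adde0 sumEFin lee_fin add1n.
apply: (@le_trans _ _ (\sum_(1 <= k < d.+1) 1)); last first.
  by rewrite big_const_nat iter_addr addr0 subn1.
rewrite big_mkcond; apply: ler_sum => k _.
by case: ifP => _ //; case: ifP.
Qed.

Lemma lower_eigenvalue_tail k : in_dim p k -> lam k < lam d -> lam d <= 2 * lam k ->
  (P (conj_deviation Sigma Xs W ((lam d - lam k) / (2 * lam d))) <=
   (8 * C3 ^+ 2 * lam k * tr / (n%:R * (lam d - lam k) ^+ 2))%:E)%E.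
Proof.
move=> hk hlt h2; have hd := in_dim_d; have [ou hSu mS] := Sigma_spectral.
have k0 : 0 < lam k by exact: lam_gt0.
have l0 : 0 < lam d by exact: lam_gt0.
set G := lam d - lam k; set l := lam d.
have G0 : 0 < G by rewrite subr_gt0.
have Gl : G <= l by rewrite gerBl ltW.
have c1 : 1 < C3 := C3_gt1.
have C30 : 0 < C3 by exact: lt_trans ltr01 C3_gt1.
have n0 : 0 < n%:R :> R by rewrite ltr0n.
(* Half the gap again, now relative to lam_d since the whitened covariance has largest eigenvalue 1;
   [K] is x^(-2). *)
pose x := G / (2 * C3 * l).
have x0 : 0 < x by rewrite divr_gt0// !mulr_gt0.
pose K := 4 * C3 ^+ 2 * l ^+ 2 / G ^+ 2.
have hK : 0 <= K by rewrite ltW// divr_gt0 ?exprn_gt0// !mulr_gt0 ?exprn_gt0.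
have := conj_deviation_tail ou X_rv X_centered X_subgaussian X_cov n_ge1 Xs_copies
  C3_def whiten_sym norm_whiten (ltW C30) whiten_largest (_ : 0 < 1 <= d%:R)
  trace_whiten x0 hK.
rewrite ltr01 ler1n d_ge1 => /(_ isT).
have -> : C3 * 1 * x = G / (2 * l) by rewrite /x; field; rewrite !gt_eqF.
move=> h; apply: le_trans (h _) _.
  rewrite /Num.min; case: ifP => _.
    have -> : K * x = 2 * C3 * (l / G) by rewrite /K /x; field; rewrite !gt_eqF.
    have z1 : 1 <= l / G by rewrite ler_pdivlMr ?mul1r.
    by move: (l / G) z1 => z z1; nra.
  have -> // : K * x ^+ 2 = 1.
  by rewrite /K /x; field; rewrite !gt_eqF.
rewrite lee_fin mulr1.
(* The factor d lam_d^2 is absorbed by d lam_d <= tr and lam_d <= 2 lam_k; the latter doubles 4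
   C3^2. *)
have -> : K * d%:R / n%:R = 4 * C3 ^+ 2 / (n%:R * G ^+ 2) * (d%:R * l * l).
  by rewrite /K; field; rewrite !gt_eqF.
have -> : 8 * C3 ^+ 2 * lam k * tr / (n%:R * G ^+ 2) =
    4 * C3 ^+ 2 / (n%:R * G ^+ 2) * (tr * (2 * lam k)).
  by field; rewrite !gt_eqF.
apply: ler_wpM2l.
  by rewrite ltW// divr_gt0 ?mulr_gt0 ?exprn_gt0.
apply: ler_pM => //; [by rewrite mulr_ge0// ltW | exact: ltW |].
exact: mul_eigenvalue_le_trace.
Qed.

Lemma whiten_tail : d%:R <= n%:R / (16 * C3 ^+ 2) ->
  (P (conj_deviation Sigma Xs W 4^-1) <= (expR (- (n%:R / (16 * C3 ^+ 2))))%:E)%E.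
Proof.
move=> hdn; have [ou _ _] := Sigma_spectral.
have c1 : 1 < C3 := C3_gt1.
have C30 : 0 < C3 by exact: lt_trans ltr01 C3_gt1.
(* As x <= 1, the minimum is x^2 = 1/(16 C3^2), and the hypothesis on [d] yields the trace
   condition. *)
pose x := (4 * C3)^-1.
have x0 : 0 < x by rewrite invr_gt0 mulr_gt0.
have x1 : x <= 1 by rewrite invf_le1 ?mulr_gt0//; lra.
have xE : n%:R * Num.min x (x ^+ 2) = n%:R / (16 * C3 ^+ 2).
  rewrite min_r; last by rewrite expr2 ler_piMr// ltW.
  by rewrite /x; field; rewrite gt_eqF.
have := conj_deviation_bound ou X_rv X_centered X_subgaussian X_cov n_ge1 Xs_copies
  C3_def whiten_sym norm_whiten whiten_largest x0.
rewrite mulr1 xE; have -> : C3 * 1 * x = 4^-1 by rewrite /x; field; rewrite gt_eqF.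
by apply; rewrite (le_trans trace_whiten).
Qed.

(** Domination is claimed only off the event at level 1/4, shared by all k; that event is charged to
    the remainder term. *)
Lemma lower_dominator k : in_dim p k -> (d < k)%N ->
  exists F : T -> \bar R, [/\ measurable_fun setT F, forall w, (0 <= F w)%E,
    forall w, ~ conj_deviation Sigma Xs W 4^-1 w ->
      (((mu - lam k) * `|proj_le (hu w) d (u k)| ^+ 2)%:E <= F w)%E &
    (\int[P]_w F w <= (C * ((mu - lam k) *
       (lam k / (n%:R * (lam d - lam k) ^+ 2))) * tr)%:E)%E].
Proof.
move=> hk dk; have hd := in_dim_d.
have [ou hSu mS] := Sigma_spectral; have /andP[mu1 mu2] := mu_range.
have lkd : lam k <= lam d.+1 by apply: mS.
have [lj|lj] := leP (lam d) (lam k).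
  have -> : lam k = mu by lra.
  exists (fun=> 0%E); split => //.
    by move=> w _; rewrite subrr mul0r.
  by rewrite integral0 subrr mul0r mulr0 mul0r.
have k0 : 0 < lam k by exact: lam_gt0.
have l0 : 0 < lam d by exact: lam_gt0.
have G0 : 0 < (lam d - lam k) / 2 by rewrite divr_gt0 ?subr_gt0.
have n0 : 0 < n%:R :> R by rewrite ltr0n.
have lam_ge0 i : in_dim p i -> 0 <= lam i by move=> hi; rewrite ltW// lam_gt0.
have a01 w : 0 <= `|proj_le (hu w) d (u k)| ^+ 2 <= 1.
  by have [hv _ _] := hSigma_spectral w; exact: sqnorm_proj_le_01 ou hv hd _ hk.
(* Off the event at level [t] the empirical eigenvalue [d] is at least (1 - t) lam_d; the condition
   on [t] keeps this half a gap above lam_k. *)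
have good w t : 0 <= t <= 1 -> lam k + (lam d - lam k) / 2 <= (1 - t) * lam d ->
    ~ conj_deviation Sigma Xs W t w ->
    ((lam d - lam k) / 2) ^+ 2 * `|proj_le (hu w) d (u k)| ^+ 2 <=
    `|sub_op Sigma (sample_covariance Xs w) (u k)| ^+ 2.
  move=> t01 ht wD.
  apply: (sqnorm_proj_le_bound _ Sigma_spectral (hSigma_spectral w)) => //.
  - exact: sample_covariance_sym.
  - exact: ltW.
  - apply: le_trans ht _; exact: (eigenvalue_lower (covariance_operator_sym X_cov)
      (sample_covariance_sym Xs w) Sigma_spectral (hSigma_spectral w) d_ltp).
have w0 : (0 <= (mu - lam k)%:E)%E by rewrite lee_fin subr_ge0 (le_trans lkd).
suff [F [mF F0 aF iF]] : exists F : T -> \bar R, [/\ measurable_fun setT F,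
    forall w, (0 <= F w)%E,
    forall w, ~ conj_deviation Sigma Xs W 4^-1 w ->
      ((`|proj_le (hu w) d (u k)| ^+ 2)%:E <= F w)%E &
    (\int[P]_w F w <= (C * (lam k / (n%:R * (lam d - lam k) ^+ 2)) * tr)%:E)%E].
  exists (fun w => (mu - lam k)%:E * F w)%E; split.
  - exact: measurable_funeM.
  - by move=> w; rewrite mule_ge0.
  - by move=> w wF; rewrite EFinM lee_wpmul2l// aF.
  rewrite ge0_integralZl// (le_trans (lee_wpmul2l w0 iF))// -EFinM lee_fin.
  have E (a b c e : R) : a * (b * c) * e = b * (a * c * e) by ring.
  by rewrite [leRHS]E.
set G := lam d - lam k; set q := lam k.
have G0' : 0 < G by rewrite subr_gt0.
have tr0 : 0 <= tr by exact: le_trans (lam_ge0 _ hk) (eigenvalue_le_trace hk).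
have [h2|h2] := leP (lam d) (2 * lam k).
  (* At this level, adapted to [k], (1 - t) lam_d is the midpoint of the gap. *)
  have t01 : 0 <= G / (2 * lam d) <= 1.
    have l2 : 0 < 2 * lam d by rewrite mulr_gt0.
    apply/andP; split; first by rewrite ltW// divr_gt0.
    by rewrite ler_pdivrMr// mul1r /G; lra.
  have mD := measurable_conj_deviation ou X_cov Xs_copies whiten_sym (proj1 (andP t01)).
  have [|F [mF F0 aF iF]] := dominated_by_deviation X_cov Xs_copies Sigma_spectral
    lam_ge0 C2_ge0 C2_bound hk mD (lower_eigenvalue_tail hk lj h2) G0 a01.
    move=> w; apply: good => //.
    have -> : (1 - G / (2 * lam d)) * lam d = lam d - G / 2.
      by field; rewrite gt_eqF.
    by rewrite /G; lra.
  exists F; split => //; apply: le_trans iF _; rewrite trace_fineE -EFinM -EFinD lee_fin.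
  by rewrite le_eqVlt; apply/orP; left; apply/eqP; rewrite -/G -/q; field; rewrite !gt_eqF.
have t01 : 0 <= (4^-1 : R) <= 1 by apply/andP; split; lra.
(* Cutting off to 0 on the event allows an empty exceptional set. Level 1/4 suffices: 3/4 lam_d
   exceeds the midpoint when lam_k < lam_d / 2. *)
pose a w := if w \in conj_deviation Sigma Xs W 4^-1 then 0
  else `|proj_le (hu w) d (u k)| ^+ 2.
have a01' w : 0 <= a w <= 1 by rewrite /a; case: ifP => //; rewrite lexx ler01.
have P0 : (P set0 <= 0%:E)%E by rewrite measure0.
have [|F [mF F0 aF iF]] := dominated_by_deviation X_cov Xs_copies Sigma_spectral
    lam_ge0 C2_ge0 C2_bound hk measurable0 P0 G0 a01'.
  move=> w _; rewrite /a; case: ifPn => [_|/negP wD]; first by rewrite mulr0 sqr_ge0.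
  apply: (good w _ t01) => [|hw]; last by apply: wD; rewrite inE.
  by lra.
exists F; split => // [w wD|]; first by have := aF w; rewrite /a memNset.
apply: le_trans iF _; rewrite trace_fineE -EFinM -EFinD lee_fin addr0 -/G -/q.
have -> : 2 * C2 * q / (n%:R * (G / 2) ^+ 2) * tr =
    8 * C2 * (q / (n%:R * G ^+ 2)) * tr by field; rewrite !gt_eqF.
rewrite ler_wpM2r// ler_wpM2r//.
  by rewrite ltW// divr_gt0// mulr_gt0 ?exprn_gt0.
by rewrite lerDl mulr_ge0 ?sqr_ge0.
Qed.

(** * Pointwise majorants of the excess risks and their integration *)

Lemma integral_constant (c : R) : (\int[P]_w c%:E = c%:E)%E.
Proof.
rewrite integral_cst// -[RHS]mule1; congr (_ * _)%E; exact: probability_setT.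
Qed.

Lemma excess_leE w : excess_le p lam u (hu w) d mu =
  (\sum_(1 <= j < d.+1) (lam j - mu) * `|proj_gt (hu w) d (u j)| ^+ 2)%:E.
Proof.
have [ou _ _] := Sigma_spectral; have hd := in_dim_d.
rewrite -sumEFin; apply: eq_big_nat => j hj; rewrite EFinM; congr (_ * _)%E.
by apply: (hs_norm_sq_proj ou (in_dimW hj hd)) => x y; exact: proj_gt_sym.
Qed.

Lemma excess_gtE w : excess_gt p lam u (hu w) d mu =
  (\sum_(d.+1 <= k <oo | in_dim p k)
     ((mu - lam k) * `|proj_le (hu w) d (u k)| ^+ 2)%:E)%E.
Proof.
have [ou _ _] := Sigma_spectral.
apply: eq_eseriesr => k hk; rewrite EFinM; congr (_ * _)%E.
by apply: (hs_norm_sq_proj ou hk) => x y; exact: proj_le_sym.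
Qed.

Lemma excess_le_bound r : (r <= d)%N ->
  (\int[P]_w excess_le p lam u (hu w) d mu
     <= C%:E *
        (\sum_(1 <= j < r.+1)
           ((lam j - mu) * (lam j / (n%:R * (lam j - lam d.+1) ^+ 2)))%:E
           * trace p u Sigma)
        + (\sum_(r.+1 <= j < (upper_index p d r).+1) (lam j - mu))%R%:E)%E.
Proof.
move=> rd; have hd := in_dim_d; have [ou hSu mS] := Sigma_spectral.
have /andP[mu1 mu2] := mu_range.
have wj0 j : (0 < j <= d)%N -> 0 <= lam j - mu.
  move=> jd; rewrite subr_ge0 (le_trans mu2)//; apply: mS => //.
    exact: in_dimW hd.
  by case/andP: jd.
(* Choosing one family needs a majorant for every index; 0 is the default outside 1, ..., d. *)
have /choice[F hF] : forall j, exists F : T -> \bar R, [/\ measurable_fun setT F,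
    forall w, (0 <= F w)%E &
    (0 < j <= d)%N ->
    (forall w, (((lam j - mu) * `|proj_gt (hu w) d (u j)| ^+ 2)%:E <= F w)%E) /\
    (\int[P]_w F w <= (C * ((lam j - mu) *
       (lam j / (n%:R * (lam j - lam d.+1) ^+ 2))) * tr)%:E)%E].
  move=> j; have [/upper_dominator[F [h1 h2 h3 h4]]|jd] := boolP (0 < j <= d)%N.
    by exists F.
  by exists (fun=> 0%E); split => // hj; rewrite hj in jd.
set c := \sum_(r.+1 <= j < _) _.
(* Terms up to [r] are dominated singly; the others are bounded pointwise in [w] by the knapsack
   constant. *)
apply: (@le_trans _ _ (\int[P]_w (\sum_(1 <= j < r.+1) F j w + c%:E))%E).
  apply: le_integral_ge0 => w; rewrite excess_leE.
    rewrite lee_fin big_nat; apply: sumr_ge0 => j hj.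
    by rewrite mulr_ge0 ?sqr_ge0// wj0.
  rewrite (big_cat_nat _ (n := r.+1))//= EFinD leeD//.
    rewrite -sumEFin [leLHS]big_nat [leRHS]big_nat; apply: lee_sum => j /andP[j0 jr].
    have [_ _ [|h _]] := hF j; last exact: h.
    by rewrite j0 (leq_trans _ rd).
  rewrite lee_fin; have [ov _ _] := hSigma_spectral w.
  apply: (weighted_sum_proj_gt ou ov hd rd (w := fun j => lam j - mu)) => //.
  move=> i j i0 /andP[ij jd]; rewrite lerB//; apply: mS => //.
    by apply: (in_dimW _ hd); rewrite i0 (leq_trans ij).
  by apply: (in_dimW _ hd); rewrite (leq_trans i0 ij).
have c0 : 0 <= c.
  rewrite /c big_nat; apply: sumr_ge0 => j /andP[rj ju]; apply: wj0.
  rewrite (leq_ltn_trans _ rj)//=; move: ju; rewrite ltnS => /leq_trans; apply.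
  by rewrite /upper_index; case: (p) => // q; exact: geq_minl.
have mF j : measurable_fun setT (F j) by have [] := hF j.
have F0 j w : (0 <= F j w)%E by have [] := hF j.
rewrite ge0_integralD//; last 2 first.
- by move=> w _; exact: sume_ge0.
- exact: emeasurable_sum.
rewrite integral_constant leeD// ge0_integral_sum//.
rewrite trace_fineE [X in (_ <= _ * X)%E](eq_bigr (fun j => ((lam j - mu) *
  (lam j / (n%:R * (lam j - lam d.+1) ^+ 2)) * tr)%:E)) => [|j _]; last by rewrite -EFinM.
rewrite sumEFin -EFinM mulr_sumr -sumEFin [leLHS]big_nat [leRHS]big_nat.
apply: lee_sum => j /andP[j0 jr]; have [_ _ [|_ h]] := hF j.
  by rewrite j0 (leq_trans _ rd).
by rewrite (le_trans h)// lee_fin -[leLHS]mulrA.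
Qed.

Lemma series_proj_le_bound w m (x : R) : (0 < m)%N -> 0 <= x ->
  (\sum_(m <= k <oo | in_dim p k) (x * `|proj_le (hu w) d (u k)| ^+ 2)%:E
   <= (x * d%:R)%:E)%E.
Proof.
move=> m0 x0; have [ou _ _] := Sigma_spectral; have [ov _ _] := hSigma_spectral w.
apply: lime_le.
  by apply: is_cvg_nneseries => k _ _; rewrite lee_fin mulr_ge0 ?sqr_ge0.
apply: nearW => N; rewrite sumEFin lee_fin -mulr_sumr ler_wpM2l//.
apply: le_trans (sum_sqnorm_proj_le (v := hu w) ou ov in_dim_d N).
rewrite [leLHS](big_nat_widenl _ 1)// big_mkcondr; apply: ler_sum => k _.
by case: ifP => // _; exact: sqr_ge0.
Qed.

(** With z = n / (32 C3^2) the hypothesis reads d <= 2 z, so 2 z <= exp z is enough. This holds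
    because exp z >= (1 + z/2)^2 and (1 + z/2)^2 - 2 z = (1 - z/2)^2. *)
Lemma mul_expR_tail : d%:R <= n%:R / (16 * C3 ^+ 2) ->
  d%:R * expR (- (n%:R / (16 * C3 ^+ 2))) <= expR (- (n%:R / (32 * C3 ^+ 2))).
Proof.
move=> hdn; have C30 : 0 < C3 by exact: lt_trans ltr01 C3_gt1.
pose z := n%:R / (32 * C3 ^+ 2).
have zE : n%:R / (16 * C3 ^+ 2) = z + z by rewrite /z; field; rewrite gt_eqF.
rewrite -/z zE opprD expRD mulrA -[leRHS]mul1r ler_wpM2r ?expR_ge0//.
rewrite expRN ler_pdivrMr ?expR_gt0// mul1r; apply: (@le_trans _ _ (z + z)).
  by rewrite -zE.
have z0 : 0 <= z by rewrite divr_ge0// mulr_ge0// sqr_ge0.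
have -> : expR z = expR (z / 2) ^+ 2 by rewrite expr2 -expRD -splitr.
have h : 1 + z / 2 <= expR (z / 2) by exact: expR_ge1Dx.
have : (1 + z / 2) ^+ 2 <= expR (z / 2) ^+ 2.
  by rewrite lerXn2r// ?nnegrE ?expR_ge0// addr_ge0// divr_ge0.
by apply: le_trans; have := sqr_ge0 (1 - z / 2); rewrite !expr2; lra.
Qed.

Lemma excess_gt_bound (l : option nat) : d%:R <= n%:R / (16 * C3 ^+ 2) ->
  admissible_index p d l ->
  (\int[P]_w excess_gt p lam u (hu w) d mu
     <= C%:E *
        sum_from p l (fun k =>
           ((mu - lam k) * (lam k / (n%:R * (lam d - lam k) ^+ 2)))%:E
           * trace p u Sigma)
        + (sum_below lam d l mu)%:E
        + ((mu - last_eigenvalue p lam)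
           * expR (- (n%:R / (32 * C3 ^+ 2))))%R%:E)%E.
Proof.
move=> hdn hl; have hd := in_dim_d; have [ou hSu mS] := Sigma_spectral.
have /andP[mu1 mu2] := mu_range.
have wk0 k : in_dim p k -> (d < k)%N -> 0 <= mu - lam k.
  by move=> hk dk; rewrite subr_ge0 (le_trans _ mu1)// mS.
have wlast k : in_dim p k -> mu - lam k <= mu - last_eigenvalue p lam.
  move=> hk; rewrite lerD2l lerN2 /last_eigenvalue.
  case pE : p => [q|]; last by rewrite ltW// lam_gt0.
  have /andP[k0 kq] : in_dim (Some q) k by rewrite -pE.
  by apply: mS => //; rewrite pE /in_dim leqnn (leq_trans k0 kq).
have last0 : 0 <= mu - last_eigenvalue p lam.
  exact: le_trans (wk0 _ d_ltp (leqnn _)) (wlast _ d_ltp).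
set L := mu - last_eigenvalue p lam in wlast last0 *.
have exc0 w : (0 <= excess_gt p lam u (hu w) d mu)%E.
  rewrite excess_gtE; apply: nneseries_ge0 => k dk hk.
  by rewrite lee_fin mulr_ge0 ?sqr_ge0// wk0.
(* For l = oo, and hence p = oo, every weight is at most [mu] and the total mass at most [d]. *)
case: l hl => [m|] hl; last first.
  have pN : p = None by move: hl; case: (p).
  have mu0 : 0 <= mu by rewrite (le_trans _ mu1)// ltW// lam_gt0.
  rewrite /sum_from mule0 add0e /sum_below -EFinD.
  apply: (@le_trans _ _ (\int[P]_w (mu * d%:R)%:E)%E).
    apply: le_integral_ge0 => // w; rewrite excess_gtE.
    apply: le_trans (series_proj_le_bound w (m := d.+1) isT mu0).
    apply: lee_nneseries => k; first by move=> dk hk; rewrite lee_fin mulr_ge0 ?sqr_ge0// wk0.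
    move=> hk; rewrite lee_fin ler_wpM2r ?sqr_ge0//.
    by rewrite gerBl ltW// lam_gt0.
  rewrite integral_constant lee_fin mulrC lerDl.
  by rewrite mulr_ge0// expR_ge0.
have [dm inm] : (d < m)%N /\ (forall k, (d < k < m)%N -> in_dim p k).
  move: hl; rewrite /admissible_index /in_dim; case: (p) => [q /andP[dm mq]|dm].
    by split=> // k /andP[dk km]; rewrite (leq_ltn_trans _ dk)//= -ltnS (leq_trans km).
  by split=> // k /andP[dk km]; rewrite (leq_ltn_trans _ dk).
have /choice[F hF] : forall k, exists F : T -> \bar R, [/\ measurable_fun setT F,
    forall w, (0 <= F w)%E &
    in_dim p k && (d < k)%N ->
    (forall w, ~ conj_deviation Sigma Xs W 4^-1 w ->
      (((mu - lam k) * `|proj_le (hu w) d (u k)| ^+ 2)%:E <= F w)%E) /\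
    (\int[P]_w F w <= (C * ((mu - lam k) *
       (lam k / (n%:R * (lam d - lam k) ^+ 2))) * tr)%:E)%E].
  move=> k; have [/andP[hk dk]|kd] := boolP (in_dim p k && (d < k)%N).
    by have [F [h1 h2 h3 h4]] := lower_dominator hk dk; exists F.
  by exists (fun=> 0%E); split => // hk; rewrite hk in kd.
have mF k : measurable_fun setT (F k) by have [] := hF k.
have F0 k w : (0 <= F k w)%E by have [] := hF k.
set D := conj_deviation Sigma Xs W 4^-1 in hF.
have mD : measurable D.
  by apply: (measurable_conj_deviation ou X_cov Xs_copies whiten_sym); rewrite invr_ge0.
set c := sum_below lam d (Some m) mu.
have cE : c = \sum_(maxn d.+1 (m - d) <= k < m) (mu - lam k) by [].
have c0 : 0 <= c.
  rewrite cE big_nat; apply: sumr_ge0 => k /andP[ck km].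
  have dk : (d < k)%N by rewrite (leq_trans (leq_maxl _ _) ck).
  by rewrite wk0// inm// dk.
pose s w := (\sum_(m <= k <oo | in_dim p k) F k w)%E.
have s0 w : (0 <= s w)%E by exact: nneseries_ge0.
have ms : measurable_fun setT s by apply: measurable_nneseries_cond.
have Ld0 : (0 <= (L * d%:R)%:E)%E by rewrite lee_fin mulr_ge0.
have D0 w : (0 <= (\1_D w)%:E :> \bar R)%E by rewrite lee_fin indicE.
have mD1 : measurable_fun setT (fun w => (\1_D w)%:E : \bar R).
  by apply/measurable_EFinP; exact: measurable_indic.
(* The terms below [m] cost the knapsack value. From [m] on, the dominators serve off [D]; on [D]
   all weights are at most [L] and the mass at most [d]. *)
apply: (@le_trans _ _ (\int[P]_w (s w + c%:E + (L * d%:R)%:E * (\1_D w)%:E))%E).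
  apply: le_integral_ge0 => // w; rewrite excess_gtE eseries_mkcond.
  rewrite (nneseries_split _ (m - d.+1)) => [|k dk]; last first.
    by case: ifP => // hk; rewrite lee_fin mulr_ge0 ?sqr_ge0// wk0.
  rewrite subnKC// -eseries_mkcond [s w + _]addeC -addeA leeD//.
    have -> : (\sum_(d.+1 <= k < m) (if in_dim p k then
        ((mu - lam k) * `|proj_le (hu w) d (u k)| ^+ 2)%:E else 0) =
        (\sum_(d.+1 <= k < m) (mu - lam k) * `|proj_le (hu w) d (u k)| ^+ 2)%:E)%E.
      by rewrite -sumEFin; apply: eq_big_nat => k hk; rewrite inm.
    rewrite lee_fin cE; have [ov _ _] := hSigma_spectral w.
    apply: (weighted_sum_proj_le ou ov hd (w := fun k => mu - lam k)) => //.
      move=> i j di /andP[ij jm]; rewrite lerB// mS//; apply: inm.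
        by rewrite di (leq_ltn_trans ij).
      by rewrite jm (leq_trans di).
    by move=> j dj; rewrite wk0 ?inm//; case/andP: dj.
  rewrite indicE; have [wD|wD] := pselect (D w).
    rewrite mem_set// mule1 (le_trans _ (leeDr _ (s0 w)))//.
    apply: le_trans (series_proj_le_bound w (leq_ltn_trans (leq0n d) dm) last0).
    apply: lee_nneseries => k; first by move=> dk hk;
      rewrite lee_fin mulr_ge0 ?sqr_ge0// wk0// (leq_trans dm).
    by move=> hk; rewrite lee_fin ler_wpM2r ?sqr_ge0// wlast.
  rewrite memNset// mule0 adde0 /s ereal_series_cond [leRHS]ereal_series_cond.
  apply: lee_nneseries => k => [_|] /andP[mk hk].
    by rewrite lee_fin mulr_ge0 ?sqr_ge0// wk0// (leq_trans dm).
  have [_ _ [|h _]] := hF k; last exact: h.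
  by rewrite hk (leq_trans dm).
have sc0 w : (0 <= s w + c%:E)%E by rewrite adde_ge0.
have msc : measurable_fun setT (fun w => s w + c%:E)%E by exact: emeasurable_funD.
rewrite ge0_integralD//; last 2 first.
- by move=> w _; rewrite mule_ge0.
- exact: measurable_funeM.
rewrite ge0_integralD// integral_constant ge0_integralZl// integral_indic// setIT.
apply: leeD; first apply: leeD => //.
  rewrite integral_nneseries_cond//.
  rewrite trace_fineE /sum_from ereal_series_cond [in leRHS]ereal_series_cond -nneseriesZl.
    apply: lee_nneseries => k; first by move=> _ _; exact: integral_ge0.
    move=> /andP[mk hk]; have [_ _ [|_ h]] := hF k.
      by rewrite hk (leq_trans dm).
    by rewrite (le_trans h)// -!EFinM lee_fin -[leLHS]mulrA.
  move=> k /andP[mk hk]; rewrite -EFinM lee_fin mulr_ge0//; last first.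
    by rewrite (le_trans _ (eigenvalue_le_trace hk))// ltW// lam_gt0.
  rewrite mulr_ge0 ?wk0//; first by rewrite (leq_trans dm).
  have lk0 : 0 <= lam k by rewrite ltW// lam_gt0.
  by apply: divr_ge0 => //; apply: mulr_ge0 => //; exact: sqr_ge0.
(* The event costs L d P(D); halving the exponent of the tail bound absorbs the factor [d]. *)
apply: le_trans (lee_wpmul2l Ld0 (whiten_tail hdn)) _.
by rewrite -EFinM lee_fin -mulrA ler_wpM2l// mul_expR_tail.
Qed.

End Dominators.

(* Divisions by zero: [x / 0] is [0] in a field, so the summands 0/0 are 0. *)
Theorem proposition2p7 (R : realType) (H : hilbertType R) (p : option nat)
    (disp : measure_display) (T : measurableType disp) (P : probability T R)
    (X : T -> H) (Sigma : H -> H) (lam : nat -> R) (u : nat -> H)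
    (n : nat) (Xs : 'I_n -> T -> H)
    (hlam : T -> nat -> R) (hu : T -> nat -> H)
    (d : nat) (C1 C2 C3 mu : R)
    (X_rv : random_vector X)
    (X_centered : has_mean P X 0)
    (X_L2 : square_integrable P X)
    (X_cov : covariance_operator P X Sigma)
    (Sigma_spectral : spectral_decomposition p Sigma lam u)
    (lam_gt0 : forall j, in_dim p j -> 0 < lam j)
    (n_ge1 : (1 <= n)%N)
    (Xs_copies : independent_copies P X Xs)
    (hSigma_spectral : forall w,
      spectral_decomposition p (sample_covariance Xs w) (hlam w) (hu w))
    (hlam_ge0 : forall w j, in_dim p j -> 0 <= hlam w j)
    (d_ge1 : (1 <= d)%N)
    (d_ltp : in_dim p d.+1)
    (C2_def : smallest_second_moment_constant p lam u P Sigma Xs C2)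
    (C3_gt1 : 1 < C3)
    (C3_def : koltchinskii_lounici C1 C3)
    (X_subgaussian : sub_gaussian P C1 X)
    (mu_range : lam d.+1 <= mu <= lam d) :
  let C := 8 * C2 + 8 * C3 ^+ 2 in
  (forall r : nat, (r <= d)%N ->
    (\int[P]_w excess_le p lam u (hu w) d mu
     <= C%:E *
        (\sum_(1 <= j < r.+1)
           ((lam j - mu) * (lam j / (n%:R * (lam j - lam d.+1) ^+ 2)))%:E
           * trace p u Sigma)
        + (\sum_(r.+1 <= j < (upper_index p d r).+1) (lam j - mu))%R%:E)%E)
  /\
  (d%:R <= n%:R / (16 * C3 ^+ 2) ->
   forall l : option nat, admissible_index p d l ->
    (\int[P]_w excess_gt p lam u (hu w) d mu
     <= C%:E *
        sum_from p l (fun k =>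
           ((mu - lam k) * (lam k / (n%:R * (lam d - lam k) ^+ 2)))%:E
           * trace p u Sigma)
        + (sum_below lam d l mu)%:E
        + ((mu - last_eigenvalue p lam)
           * expR (- (n%:R / (32 * C3 ^+ 2))))%R%:E)%E).
Proof.
have [C2_gt0 C2_bound _] := C2_def.
split=> [r rd|hdn l hl].
  exact: (excess_le_bound X_rv X_centered X_L2 X_cov Sigma_spectral lam_gt0 n_ge1
    Xs_copies hSigma_spectral d_ge1 d_ltp (ltW C2_gt0) C2_bound C3_gt1 C3_def
    X_subgaussian mu_range rd).
exact: (excess_gt_bound X_rv X_centered X_L2 X_cov Sigma_spectral lam_gt0 n_ge1
  Xs_copies hSigma_spectral d_ge1 d_ltp (ltW C2_gt0) C2_bound C3_gt1 C3_def
  X_subgaussian mu_range hdn hl).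
Qed.
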